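(* Let $T:L_1(\Omega,X)\rightarrow L_1(\Omega,X)$ be a linear operator positively dominated by an $L_1-L_\infty$ contraction $T'$ in $L_1$, and let $S_nf=\frac1n\sum_{i=0}^{n-1}T^if$. If $p>1$, $f\in L_p(\Omega,X)$ and $\sup_{n_1}\|S_{n_1}f\|_X\in L_1$, then 1. $$\Big\|\sup_{n_1,n_2}\|E(S_{n_1}f|F_{n_2})\|_X\Big\|_p\le\left(\frac p{p-1}\right)^2\|f\|_p.$$ 2. For every $\varepsilon>0$, $$\mu\Big\{\sup_{n_1,n_2}\|E(S_{n_1}f|F_{n_2})\|_X\ge\varepsilon\Big\}\le\left(\frac p{p-1}\right)^p\frac{\|f\|_p^p}{\varepsilon^p}.$$
   Context: $X$ is a reflexive Banach space with norm $\|\cdot\|_X$, and $(\Omega,\beta,\mu)$ is a finite measure space. For $1\le p<\infty$, $L_p(\Omega,X)$ is the Banach space of (strongly) measurable functions $f:\Omega\to X$ with finite norm $\|f\|_p=\left(\int_\Omega\|f(\omega)\|_X^p\,d\mu\right)^{1/p}$, and $\|f\|_\infty=\inf\{\lambda:\|f(\omega)\|_X\le\lambda\text{ a.e.}\}$; $L_p$ denotes the space for $X=\mathbb R$. For $f$ with values in $X$, $\|f\|_X$ denotes the function $\omega\mapsto\|f(\omega)\|_X$. $E(f|F)$ is the conditional expectation of $f$ with respect to a $\sigma$-subalgebra $F\subset\beta$. $(F_n)_{n\ge1}$ is a monotone (increasing or decreasing) sequence of $\sigma$-subalgebras of $\beta$, with $F_n\uparrow F_\infty$ or $F_n\downarrow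 F_\infty$. A linear operator $T$ in $L_1(\Omega,X)$ is positively dominated if there is a positive linear contraction $T'$ in $L_1$, called a positive dominant of $T$, with $\|Tf\|_X\le T'(\|f\|_X)$ a.e. for all $f$; one then says $T$ is positively dominated by $T'$. A linear operator is an $L_1-L_\infty$ contraction if $\|Tf\|_1\le\|f\|_1$ and $\|Tf\|_\infty\le\|f\|_\infty$. *)

(* Defs.v *)
From HB Require Import structures.
From mathcomp Require Import all_boot all_order all_algebra.
From mathcomp Require Import all_classical all_reals all_analysis.

Set Implicit Arguments.
Unset Strict Implicit.
Unset Printing Implicit Defensive.

Import Order.TTheory GRing.Theory Num.Theory.
Import numFieldNormedType.Exports.

Local Open Scope classical_set_scope.
Local Open Scope ring_scope.

Section reflexivity.
Context {R : realType}.

Definition dual (X : normedModType R) : set (X -> R) :=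
  [set phi | linear (phi : X -> R^o) /\ continuous phi].

Definition dual_norm (X : normedModType R) (phi : X -> R) : R :=
  sup [set `|phi x| | x in [set x : X | `|x| <= 1]].

(* A functional on the dual is encoded by its values on all functions X -> R;
   the ones outside [dual X] are irrelevant. *)
Definition bidual (X : normedModType R) : set ((X -> R) -> R) :=
  [set Phi |
    (forall (a : R) (phi psi : X -> R), dual phi -> dual psi ->
       Phi (fun x => a * phi x + psi x) = a * Phi phi + Phi psi) /\
    (exists C : R, forall phi : X -> R, dual phi ->
       `|Phi phi| <= C * dual_norm phi)].

(* The canonical embedding of X into its bidual is onto. *)
Definition reflexive_space (X : normedModType R) : Prop :=
  forall Phi, @bidual X Phi ->
    exists x : X, forall phi : X -> R, dual phi -> Phi phi = phi x.

End reflexivity.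

Section strong_measurability.
Context {Om : Type} {R : realType} {V : normedModType R}.
Implicit Types (G : set_system Om) (s f : Om -> V).

Definition simple_fun G s : Prop :=
  finite_set (range s) /\ forall v : V, G (s @^-1` [set v]).

(* Functions are kept as such, not up to a.e. equality. Every a.e. class of
   Bochner measurable functions has a representative that is everywhere the
   pointwise limit of simple functions. *)
Definition strongly_measurable G f : Prop :=
  exists s_ : nat -> Om -> V,
    (forall n, simple_fun G (s_ n)) /\
    (forall w, s_ n w @[n --> \oo] --> f w).

End strong_measurability.

Section bochner.
Context {d : measure_display} {Om : measurableType d} {R : realType}.
Variable mu : {finite_measure set Om -> \bar R}.
Context {V : normedModType R}.
Implicit Types (p : \bar R) (s f g : Om -> V) (A : set Om).

Definition Bnorm p f : \bar R := ('N[mu]_p [(fun w => (`|f w|)%:E)])%E.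

Definition LB p : set (Om -> V) :=
  [set f | strongly_measurable measurable f /\ (Bnorm p f < +oo)%E].

Definition simple_integral A s : V :=
  \sum_(v \in range s) fine (mu (A `&` s @^-1` [set v])) *: v.

Definition is_bochner_integral A f (v : V) : Prop :=
  exists s_ : nat -> Om -> V,
    [/\ forall n, simple_fun measurable (s_ n),
        (\int[mu]_(w in A) (`|f w - s_ n w|)%:E)%E @[n --> \oo] --> 0%E &
        simple_integral A (s_ n) @[n --> \oo] --> v].

(* 0 is a junk value for functions that are not Bochner integrable *)
Definition bochner_integral A f : V := xget 0 (is_bochner_integral A f).

(* [g] is a version of E(f|G) *)
Definition is_cond_expectation (G : set_system Om) f g : Prop :=
  [/\ strongly_measurable G g,
      (Bnorm 1%:E g < +oo)%E &
      forall A, G A -> bochner_integral A g = bochner_integral A f].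

(* An operator in L_1 is a map on functions, well defined and linear on L_1 up
   to a.e. equality; its values outside L_1 are irrelevant. *)
Definition L1_operator (T : (Om -> V) -> (Om -> V)) : Prop :=
  [/\ forall f, LB 1%:E f -> LB 1%:E (T f),
      forall f g, LB 1%:E f -> LB 1%:E g ->
        {ae mu, forall w, f w = g w} -> {ae mu, forall w, T f w = T g w} &
      forall (a : R) f g, LB 1%:E f -> LB 1%:E g ->
        {ae mu, forall w,
          T (fun w' => a *: f w' + g w') w = a *: T f w + T g w}].

Definition L1_contraction (T : (Om -> V) -> (Om -> V)) : Prop :=
  forall f, LB 1%:E f -> (Bnorm 1%:E (T f) <= Bnorm 1%:E f)%E.

(* The second bound is void when f is not essentially bounded. *)
Definition L1_Loo_contraction (T : (Om -> V) -> (Om -> V)) : Prop :=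
  L1_contraction T /\
  forall f, LB 1%:E f -> (Bnorm +oo (T f) <= Bnorm +oo f)%E.

Definition ergodic_mean (T : (Om -> V) -> (Om -> V)) (n : nat) f : Om -> V :=
  fun w => n%:R^-1 *: \sum_(i < n) iter i T f w.

End bochner.

Section domination.
Context {d : measure_display} {Om : measurableType d} {R : realType}.
Variable mu : {finite_measure set Om -> \bar R}.

Definition positive_operator (T' : (Om -> R^o) -> (Om -> R^o)) : Prop :=
  forall f : Om -> R^o, LB mu 1%:E f ->
    {ae mu, forall w, (0 : R) <= f w} -> {ae mu, forall w, (0 : R) <= T' f w}.

Definition positive_dominant {X : normedModType R}
    (T : (Om -> X) -> (Om -> X)) (T' : (Om -> R^o) -> (Om -> R^o)) : Prop :=
  [/\ L1_operator mu T', positive_operator T', L1_contraction mu T' &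
      forall f, LB mu 1%:E f ->
        {ae mu, forall w, `|T f w| <= T' (fun w' => `|f w'| : R^o) w}].

End domination.

Section maximal.
Context {Om : Type} {R : realType} {V : normedModType R}.
Local Open Scope ereal_scope.

(* Sequences are indexed by the positive integers. *)
Definition sup_norm (h : nat -> Om -> V) (w : Om) : \bar R :=
  ereal_sup [set (`|h n w|%R)%:E | n in [set n | (0 < n)%N]].

Definition sup_norm2 (h : nat -> nat -> Om -> V) (w : Om) : \bar R :=
  ereal_sup [set (`|h n1 n2 w|%R)%:E | n1 in [set n | (0 < n)%N]
                                     & n2 in [set n | (0 < n)%N]].

End maximal.

Definition monotone_sub_sigma_algebras {d : measure_display}
    {Om : measurableType d} (F : nat -> set_system Om) : Prop :=
  (forall n, (0 < n)%N -> sigma_algebra setT (F n) /\ F n `<=` measurable) /\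
  ((forall m n, (0 < m <= n)%N -> F m `<=` F n) \/
   (forall m n, (0 < m <= n)%N -> F n `<=` F m)).

(* Main.v *)
Require Import Defs.
From HB Require Import structures.
From mathcomp Require Import all_boot all_order all_algebra.
From mathcomp Require Import all_classical all_reals all_analysis.
From mathcomp Require Import measurable_realfun ess_sup_inf.
From mathcomp Require Import zify ring lra.

Set Implicit Arguments.
Unset Strict Implicit.
Unset Printing Implicit Defensive.

Import Order.TTheory GRing.Theory Num.Theory.
Import numFieldNormedType.Exports.

Local Open Scope classical_set_scope.
Local Open Scope ring_scope.

(** The proof rests on one real-variable principle.  If [M] and [g] are
nonnegative and satisfy the weak inequality
[l * mu {M > l} <= \int_{M > l} g] for every [l > 0], then
[\int M^p <= (p / (p - 1))^p * \int g^p] ([weak_to_strong]) and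
[l^p * mu {M > l} <= \int g^p] ([weak_type_Lp]).  It is used twice, the
ergodic maximal function [g = sup_n |S_n f|] standing in the middle.

Ergodic step: [g] is weakly dominated by [|f|] ([ergodic_maximal]).  Hopf's
maximal ergodic theorem is applied to the positive operator [T'] and to
[psi = |f| - l].  The functions [M_0 = 0], [M_(n+1) = (psi + T' M_n)^+]
increase, and integrating [M_(n+1) <= psi + T' M_(n+1)] over
[{M_(n+1) > 0}] gives [\int psi >= 0] there, because [T'] contracts [L_1]
([hopf_maximal]).  Since [T' 1 <= 1] and [|T h| <= T' |h|], induction on [n]
yields [|f + T f + ... + T^(n-1) f| <= M_n + n l], so [{g > l}] is covered by
the sets [{M_n > 0}]; outside [{g > l}] one has [|f| = |S_1 f| <= l], whence
the excess of the covering only helps.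

Martingale step: the double maximal function is weakly dominated by [g]
([doob_maximal]).  For [A] in [F_n2],
[\int_A |E(S_n1 f | F_n2)| <= \int_A |S_n1 f| <= \int_A g]
([cond_expectation_norm_le]).  Enumerate finitely many pairs [(n1, n2)] so
that the sigma-algebras grow along the enumeration; for a decreasing family
[n2] is read backwards.  Cutting the set where some [|E(S_n1 f | F_n2)|]
exceeds [l] according to the first such pair produces pieces on which the
previous inequality applies ([first_hitting_maximal]).

The first bound is the composition of the two strong inequalities.  The
second is the weak inequality for the martingale step composed with the
strong inequality for the ergodic step. *)

(** * From weak to strong maximal inequalities *)

Lemma powR_continuous (R : realType) (a x : R) : 0 < x ->
  {for x, continuous (powR (R:=R) ^~ a)}.
Proof.
move=> x0; apply/differentiable_continuous/derivable1_diffP.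
by apply: derivable_powR; rewrite in_itv/= andbT.
Qed.

Lemma integral_powR (R : realType) (a b : R) : 0 < a -> 0 <= b ->
  (\int[lebesgue_measure]_(s in `[0%R, b]) (s `^ a)%:E =
   (b `^ (a + 1) / (a + 1))%:E)%E.
Proof.
move=> a0; rewrite le_eqVlt => /predU1P[<-|b0].
  rewrite set_itv1 integral_set1 powR0 ?mul0r//.
  by rewrite gt_eqF// addr_gt0.
have a10 : 0 < a + 1 by rewrite addr_gt0.
have c0 c : 0 < c -> (powR (R:=R) ^~ c) x @[x --> 0^'+] --> 0 `^ c.
  by move=> c0; rewrite powR0 ?gt_eqF//; exact: powR_cvg0.
have cb c : (powR (R:=R) ^~ c) x @[x --> b^'-] --> b `^ c.
  by apply: cvg_at_left_filter; exact: powR_continuous.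
rewrite (@continuous_FTC2 _ _ (fun s => (a + 1)^-1 *: (s `^ (a + 1) : R^o)))//.
- by rewrite powR0 ?gt_eqF// scaler0 sube0 /GRing.scale/= mulrC.
- apply/continuous_within_itvP => //; split => //; last exact: c0.
  by move=> x; rewrite in_itv/= => /andP[x0 _]; exact: powR_continuous.
- split.
  + move=> x; rewrite in_itv/= => /andP[x0 _].
    by apply: derivableZ; apply: derivable_powR; rewrite in_itv/= andbT.
  + by apply: cvgZr; exact: c0.
  + by apply: cvgZr; exact: cb.
- move=> x; rewrite in_itv/= => /andP[x0 _].
  rewrite derive1E deriveZ/=; last first.
    by apply: derivable_powR; rewrite in_itv/= andbT.
  rewrite -derive1E powR_derive1 ?in_itv/= ?andbT//.
  by rewrite addrK /GRing.scale/= mulrA mulVf ?mul1r// gt_eqF.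
Qed.
Lemma integral_mul_indic d (T : measurableType d) (R : realType)
    (mu : {measure set T -> \bar R}) (D : set T) (h : T -> \bar R) :
  (\int[mu]_x (h x * (\1_D x)%:E) = \int[mu]_(x in D) h x)%E.
Proof.
rewrite [RHS]integral_mkcond; apply: eq_integral => x _.
by rewrite patchE indicE; case: ifPn; rewrite (mule1, mule0).
Qed.

Section weak_to_strong.
Context d (T : measurableType d) (R : realType).
Variable mu : {finite_measure set T -> \bar R}.
Local Open Scope ereal_scope.

(** Integrating the weak inequality over the levels [l] against
[d (l^(p-1))] turns the left side into [(p - 1) / p * \int m^p] and the right
side into [\int g m^(p-1)].  The levels are parametrized by [s = l^(p-1)], so
that the measure is [ds] and the only integral to compute is that of
[s^(1/(p-1))], which is continuous at [0] even when [p < 2]. *)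
Lemma weak_type_power_integral (p : R) (m : T -> R) (g : T -> \bar R) :
  (1 < p)%R -> measurable_fun setT m -> (forall x, 0 <= m x)%R ->
  measurable_fun setT g -> (forall x, 0 <= g x) ->
  (forall l : R, (0 < l)%R ->
     l%:E * mu [set x | (l < m x)%R] <= \int[mu]_(x in [set x | (l < m x)%R]) g x) ->
  ((p - 1) / p)%:E * \int[mu]_x (m x `^ p)%:E <=
    \int[mu]_x (g x * (m x `^ (p - 1))%:E).
Proof.
move=> p1 mm m0 mg g0 hweak.
have p0 : (0 < p)%R by exact: lt_trans p1.
have p10 : (0 < p - 1)%R by rewrite subr_gt0.
pose al := ((p - 1)^-1)%R; have al0 : (0 < al)%R by rewrite invr_gt0.
pose a x := (m x `^ (p - 1))%R.
have a0 x : (0 <= a x)%R by exact: powR_ge0.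
have ma : measurable_fun setT a by exact: (measurableT_comp (measurable_powR _)).
have mlt l : measurable [set x | (l < m x)%R].
  have -> : [set x | (l < m x)%R] = m @^-1` `]l, +oo[.
    by apply/seteqP; split => x /=; rewrite in_itv/= andbT.
  by rewrite -[X in measurable X]setTI; exact: mm.
(* the region under the graph of m^(p-1), in the coordinates (x, s) *)
pose B : set (T * R) := [set z | (0 <= z.2)%R && (z.2 < a z.1)%R].
have mB : measurable B.
  rewrite -[B]setTI.
  apply: (@measurable_and _ _ setT (fun z : T * R => (0 <= z.2)%R)
     (fun z => (z.2 < a z.1)%R)) => //.
  - exact: measurable_fun_ler.
  - by apply: measurable_fun_ltr => //; exact: measurableT_comp.
have mI : measurable_fun setT (fun z => (\1_B z)%:E : \bar R).
  by apply/measurable_EFinP; exact: measurable_indic.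
pose F1 (z : T * R) : \bar R := g z.1 * (\1_B z)%:E.
pose F2 (z : T * R) : \bar R := (z.2 `^ al)%:E * (\1_B z)%:E.
have F1_ge0 z : 0 <= F1 z by rewrite mule_ge0// lee_fin.
have F2_ge0 z : 0 <= F2 z by rewrite mule_ge0// lee_fin// powR_ge0.
have mF1 : measurable_fun setT F1.
  by apply: emeasurable_funM => //; exact: measurableT_comp.
have mF2 : measurable_fun setT F2.
  apply: emeasurable_funM => //; apply/measurable_EFinP.
  exact: (measurableT_comp (measurable_powR _)).
have BE x : (fun s => \1_B (x, s) : R) = \1_(`[0%R, a x[ : set R).
  by apply/funext => s; rewrite !indicE; congr (_ %:R); apply/idP/idP;
    rewrite !inE/= in_itv.
have I1 : \int[mu]_x \int[lebesgue_measure]_s F1 (x, s) =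
    \int[mu]_x (g x * (a x)%:E).
  apply: eq_integral => x _; rewrite /F1/=.
  rewrite ge0_integralZl//; last first.
    by apply/measurable_EFinP; rewrite BE.
  congr (_ * _).
  transitivity (\int[lebesgue_measure]_s (\1_(`[0%R, a x[ : set R) s)%:E).
    by apply: eq_integral => s _; rewrite -BE.
  rewrite integral_indic// setIT.
  transitivity (lebesgue_measure (`[0%R, a x[%classic : set R)) => //.
  rewrite lebesgue_measure_itv/= lte_fin.
  by case: ltP => [_|a0']; rewrite ?oppr0 ?adde0// ?mule0//;
    have -> : a x = 0%R; rewrite ?mule0//; apply/le_anti/andP.
have I2 : \int[mu]_x \int[lebesgue_measure]_s F2 (x, s) =
    ((p - 1) / p)%:E * \int[mu]_x (m x `^ p)%:E.
  rewrite -ge0_integralZl//; last 3 first.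
  - by apply/measurable_EFinP; exact: (measurableT_comp (measurable_powR _)).
  - by move=> x _; rewrite lee_fin powR_ge0.
  - by rewrite lee_fin divr_ge0// ltW.
  apply: eq_integral => x _; rewrite /F2/=.
  transitivity (\int[lebesgue_measure]_s
      ((s `^ al)%:E * (\1_(`[0%R, a x[ : set R) s)%:E)).
    by apply: eq_integral => s _; rewrite -BE.
  rewrite integral_mul_indic integral_itv_bndo_bndc; last first.
    by apply/measurable_EFinP/measurable_funTS; exact: measurable_powR.
  rewrite integral_powR// -EFinM; congr _%:E.
  rewrite /a -powRrM.
  have -> : (al + 1 = p / (p - 1))%R by rewrite /al; field; rewrite gt_eqF.
  rewrite mulrCA mulfV ?gt_eqF// mulr1 invf_div; ring.
rewrite -I1 -I2 !fubini_tonelli//.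
apply: ge0_le_integral => //.
- by move=> s _; apply: integral_ge0.
- exact: measurable_fun_fubini_tonelli_G.
- exact: measurable_fun_fubini_tonelli_G.
move=> s _; rewrite /F1 /F2/=.
have [s0|s0] := leP s 0%R.
  have zE x : (s < 0)%R -> (\1_B (x, s) : R) = 0%R.
    move=> s0'; rewrite indicE memNset// => /andP[/= s1 _].
    by move: (le_lt_trans s1 s0'); rewrite ltxx.
  move: s0; rewrite le_eqVlt => /predU1P[->|s0]; last first.
    by rewrite !integral0_eq// => x _; rewrite zE// mule0.
  rewrite integral0_eq; first by apply: integral_ge0 => x _; exact: (F1_ge0 (x, _)).
  by move=> x _; rewrite powR0 ?gt_eqF// mul0e.
have BsE : (fun x => \1_B (x, s) : R) = \1_[set x | (s `^ al < m x)%R].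
  apply/funext => x; rewrite !indicE; congr ((nat_of_bool _)%:R)%R.
  apply/idP/idP => [/set_mem/andP[_ /= sa]|/set_mem/= sa]; apply/mem_set => /=.
    rewrite -[ltRHS](@powRr1 _ (m x))// -[X in (_ < _ `^ X)%R](mulfV (lt0r_neq0 p10)).
    by rewrite powRrM; apply: gt0_ltr_powR; rewrite ?nnegrE ?(ltW s0) ?a0.
  apply/andP; split => /=; first exact: ltW.
  rewrite -[ltLHS](@powRr1 _ s) ?ltW// -[X in (_ `^ X < _)%R](mulVf (lt0r_neq0 p10)).
  by rewrite powRrM; apply: gt0_ltr_powR; rewrite ?nnegrE ?powR_ge0 ?m0.
pose D := [set x | (s `^ al < m x)%R].
rewrite (eq_integral (fun x => (s `^ al)%:E * (\1_D x)%:E)); last first.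
  by move=> x _; rewrite -BsE.
rewrite [leRHS](eq_integral (fun x => g x * (\1_D x)%:E)); last first.
  by move=> x _; rewrite -BsE.
rewrite !integral_mul_indic integral_cst; last exact: mlt.
by apply: hweak; rewrite powR_gt0.
Qed.
(** Young's inequality bounds [g m^(p-1)] by a combination of [g^p] and
[m^p] whose second term can be absorbed; the absorption needs
[\int m^p] to be finite, hence the bound [N] on [m]. *)
Lemma weak_to_strong_bounded (p N : R) (m : T -> R) (g : T -> \bar R) :
  (1 < p)%R -> measurable_fun setT m -> (forall x, 0 <= m x <= N)%R ->
  measurable_fun setT g -> (forall x, 0 <= g x) ->
  (forall l : R, (0 < l)%R ->
     l%:E * mu [set x | (l < m x)%R] <= \int[mu]_(x in [set x | (l < m x)%R]) g x) ->
  \int[mu]_x (m x `^ p)%:E <= ((p / (p - 1)) `^ p)%:E * \int[mu]_x (g x `^ p).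
Proof.
move=> p1 mm mN mg g0 hweak.
have p0 : (0 < p)%R by exact: lt_trans p1.
have p10 : (0 < p - 1)%R by rewrite subr_gt0.
have m0 x : (0 <= m x)%R by case/andP: (mN x).
have := weak_type_power_integral p1 mm m0 mg g0 hweak.
set I := \int[mu]_x (m x `^ p)%:E; set G := \int[mu]_x (g x `^ p).
pose k := ((p - 1) / p)%R; pose c := ((p / (p - 1)) `^ p)%R.
have k0 : (0 < k)%R by rewrite divr_gt0.
have c0 : (0 < c)%R by rewrite powR_gt0// divr_gt0.
rewrite -/k -/c => kI.
have mmp : measurable_fun setT (fun x => (m x `^ p)%:E).
  by apply/measurable_EFinP; exact: (measurableT_comp (measurable_powR _)).
have mgp : measurable_fun setT (fun x => g x `^ p).
  exact: (measurableT_comp (measurable_poweR _)).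
have I0 : 0 <= I by apply: integral_ge0 => x _; rewrite lee_fin powR_ge0.
have G0 : 0 <= G by apply: integral_ge0 => x _; exact: poweR_ge0.
have Ifin : I \is a fin_num.
  rewrite ge0_fin_numE//; apply: (@le_lt_trans _ _ (\int[mu]_x (N `^ p)%:E)).
    apply: ge0_le_integral => //; first by move=> x _; rewrite lee_fin powR_ge0.
    move=> x _; rewrite lee_fin; case/andP: (mN x) => mx0 mxN.
    by apply: ge0_ler_powR; rewrite ?nnegrE ?(le_trans mx0 mxN) ?(ltW p0).
  rewrite integral_cst// lte_mul_pinfty//; first by rewrite lee_fin powR_ge0.
  by rewrite ltey_eq fin_num_measure.
(* Young's inequality for (p / (p-1)) g and m^(p-1), multiplied by
   k = (p-1) / p: this normalization makes the final constant sharp *)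
have young x : g x * (m x `^ (p - 1))%:E <=
    (k * c / p)%:E * g x `^ p + (k * k)%:E * (m x `^ p)%:E.
  have := g0 x; case: (g x) => [r||]//; last first.
    move=> _; rewrite poweRyr ?gt_eqF// gt0_muley; last first.
      by rewrite lte_fin !mulr_gt0// invr_gt0.
    by rewrite addye ?leey.
  rewrite lee_fin => r0; rewrite poweR_EFin -!EFinM -EFinD lee_fin.
  have pp1 : (0 <= p / (p - 1))%R by rewrite divr_ge0// ?ltW.
  have pq1 : (p^-1 + (p / (p - 1))^-1 = 1)%R by field; rewrite !gt_eqF.
  have := conjugate_powR (mulr_ge0 r0 pp1) (powR_ge0 (m x) (p - 1)%R) p0
    (divr_gt0 p0 p10) pq1.
  rewrite -powRrM [X in (_ `^ X / (p / _))%R](_ : _ = p); last first.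
    by field; rewrite gt_eqF.
  rewrite powRM// -/c => /(ler_wpM2l (ltW k0)).
  rewrite -[in X in (X <= _)%R -> _](_ : (r * m x `^ (p - 1) =
    k * (r * (p / (p - 1)) * m x `^ (p - 1)))%R); last first.
    by rewrite /k; field; rewrite !gt_eqF.
  move=> /le_trans; apply; rewrite le_eqVlt; apply/predU1P; left.
  by rewrite /k; field; rewrite !gt_eqF.
have kk0 : (0 <= k * k)%R by exact: mulr_ge0 (ltW k0) (ltW k0).
have kcp0 : (0 <= k * c / p)%R by exact: divr_ge0 (mulr_ge0 (ltW k0) (ltW c0)) (ltW p0).
have {}kI : k%:E * I <= (k * c / p)%:E * G + (k * k)%:E * I.
  apply: (le_trans kI).
  rewrite -!ge0_integralZl//; last 2 first.
  - by move=> x _; rewrite lee_fin powR_ge0.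
  - by move=> x _; exact: poweR_ge0.
  rewrite -ge0_integralD//; last 4 first.
  - by move=> x _; rewrite mule_ge0 ?poweR_ge0.
  - exact: measurable_funeM.
  - by move=> x _; rewrite mule_ge0 ?lee_fin ?powR_ge0.
  - exact: measurable_funeM.
  apply: ge0_le_integral => //.
  - by move=> x _; rewrite mule_ge0// lee_fin powR_ge0.
  - apply: emeasurable_funM => //; apply/measurable_EFinP.
    exact: (measurableT_comp (measurable_powR _)).
  - by apply: emeasurable_funD; exact: measurable_funeM.
move: Ifin I0 kI; case: I => // i _; rewrite lee_fin => i0.
move: G0; case: G => [G||]//; last first.
  by move=> _ _; rewrite gt0_muley ?leey// lte_fin.
rewrite lee_fin => G0; rewrite -!EFinM -EFinD !lee_fin => h.
have : (k * i <= k * (c / p * G + k * i))%R.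
  by rewrite (le_trans h)// le_eqVlt; apply/predU1P; left; ring.
rewrite ler_pM2l// => {}h.
have : (i / p <= (c * G) / p)%R.
  rewrite (_ : (i / p = i - k * i)%R).
    by rewrite lerBlDr (le_trans h)// le_eqVlt; apply/predU1P; left; ring.
  by rewrite /k; field; rewrite gt_eqF.
by rewrite ler_pM2r// invr_gt0.
Qed.
Lemma cvg_truncation_powR (p : R) (y : \bar R) : (1 < p)%R -> 0 <= y ->
  (fine (mine y n%:R%:E) `^ p)%:E @[n --> \oo] --> y `^ p.
Proof.
move=> p1; have p0 : (0 < p)%R by exact: lt_trans p1.
case: y => [r||]//; last first.
  move=> _; rewrite poweRyr ?gt_eqF//; apply/cvgeyPge => A.
  near=> n; rewrite minye/= lee_fin.
  have n1 : (1 <= n%:R :> R)%R by rewrite ler1n; near: n; exact: nbhs_infty_gt.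
  apply: (@le_trans _ _ n%:R); last by rewrite le1r_powR// ltW.
  by near: n; exact: nbhs_infty_ger.
rewrite lee_fin => r0; rewrite poweR_EFin.
apply: cvg_near_cst; near=> n; congr (_ `^ _)%:E.
rewrite -EFin_min/= min_l//.
by near: n; exact: nbhs_infty_ger.
Unshelve. all: by end_near. Qed.

(** The truncations [min(M, n)] inherit the weak inequality, because their
level sets are those of [M] below [n] and empty above. *)
Lemma weak_to_strong (p : R) (M g : T -> \bar R) :
  (1 < p)%R -> measurable_fun setT M -> (forall x, 0 <= M x) ->
  measurable_fun setT g -> (forall x, 0 <= g x) ->
  (forall l : R, (0 < l)%R ->
     l%:E * mu [set x | l%:E < M x] <= \int[mu]_(x in [set x | l%:E < M x]) g x) ->
  \int[mu]_x (M x `^ p) <= ((p / (p - 1)) `^ p)%:E * \int[mu]_x (g x `^ p).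
Proof.
move=> p1 mM M0 mg g0 hweak.
have p0 : (0 < p)%R by exact: lt_trans p1.
pose m (n : nat) x : R := fine (mine (M x) n%:R%:E).
have mE n x : (m n x)%:E = mine (M x) n%:R%:E.
  rewrite /m fineK// ge0_fin_numE; first by rewrite gt_min ltry orbT.
  by rewrite le_min M0 lee_fin ler0n.
have m0 n x : (0 <= m n x <= n%:R)%R.
  by rewrite -!lee_fin mE le_min M0 lee_fin ler0n/= ge_min lexx orbT.
have mm n : measurable_fun setT (m n).
  apply/measurable_EFinP; rewrite (_ : _ \o _ = fun x => mine (M x) n%:R%:E).
    exact: measurable_mine.
  by apply/funext => x /=.
have mmp n : measurable_fun setT (fun x => (m n x `^ p)%:E).
  by apply/measurable_EFinP; exact: (measurableT_comp (measurable_powR _)).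
rewrite (eq_integral (fun x => limn (fun n => (m n x `^ p)%:E))); last first.
  by move=> x _; apply/esym/cvg_lim => //; exact: cvg_truncation_powR.
have nd x : {homo (fun n => (m n x `^ p)%:E) : n k / (n <= k)%N >-> n <= k}.
  move=> n k nk; rewrite lee_fin; apply: ge0_ler_powR.
  - exact: ltW.
  - by rewrite nnegrE; case/andP: (m0 n x).
  - by rewrite nnegrE; case/andP: (m0 k x).
  - by rewrite -lee_fin !mE le_min !ge_min lexx/= lee_fin ler_nat nk orbT.
rewrite monotone_convergence//; last first.
  by move=> n x _; rewrite lee_fin powR_ge0.
apply: lime_le.
  apply: ereal_nondecreasing_is_cvgn => n k nk; apply: ge0_le_integral => //.
  - by move=> x _; rewrite lee_fin powR_ge0.
  - by move=> x _; exact: nd.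
apply: nearW => n; apply: (weak_to_strong_bounded (N := n%:R)) => // l l0.
have [ln|nl] := ltP l n%:R%R.
  suff -> : [set x | (l < m n x)%R] = [set x | l%:E < M x] by exact: hweak.
  by apply/seteqP; split=> x /=; rewrite -lte_fin mE lt_min lte_fin ln andbT.
suff -> : [set x | (l < m n x)%R] = set0 by rewrite measure0 mule0 integral_set0.
apply/seteqP; split=> x //=; rewrite -lte_fin mE lt_min => /andP[_].
by rewrite lte_fin ltNge nl.
Qed.

(** The tangent line at [l] to the convex function [t^p] bounds [g^p] below
by an affine function of [g], to which the hypothesis applies. *)
Lemma weak_type_Lp (p l : R) (A : set T) (g : T -> \bar R) :
  (1 < p)%R -> (0 < l)%R -> measurable A ->
  measurable_fun setT g -> (forall x, 0 <= g x) ->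
  l%:E * mu A <= \int[mu]_(x in A) g x ->
  (l `^ p)%:E * mu A <= \int[mu]_x (g x `^ p).
Proof.
move=> p1 l0 mA mg g0 hweak.
have p0 : (0 < p)%R by exact: lt_trans p1.
have p10 : (0 < p - 1)%R by rewrite subr_gt0.
have mgp : measurable_fun setT (fun x => g x `^ p).
  exact: (measurableT_comp (measurable_poweR _)).
apply: (@le_trans _ _ (\int[mu]_(x in A) (g x `^ p))); last first.
  by apply: ge0_subset_integral => // x _; exact: poweR_ge0.
have lp0 : (0 < l `^ (p - 1))%R by exact: powR_gt0.
have lpE : (l `^ p = l `^ (p - 1) * l)%R.
  by rewrite mulrC mulr_powRB1// ltW.
pose c : R := (l `^ p * (1 - p^-1))%R.
have c0 : (0 <= c)%R by rewrite mulr_ge0 ?powR_ge0// subr_ge0 invf_le1// ltW.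
(* the tangent line inequality, written as Young's inequality for g and
   l^(p-1) *)
have young x : (l `^ (p - 1))%:E * g x <= (p^-1)%:E * g x `^ p + c%:E.
  have := g0 x; case: (g x) => [r||]//; last first.
    move=> _; rewrite poweRyr ?gt_eqF// [X in _ <= X + _]gt0_muley.
      by rewrite addye ?leey.
    by rewrite lte_fin invr_gt0.
  rewrite lee_fin => r0; rewrite poweR_EFin -!EFinM -EFinD lee_fin.
  have pq1 : (p^-1 + (p / (p - 1))^-1 = 1)%R by field; rewrite !gt_eqF.
  have := conjugate_powR r0 (powR_ge0 l (p - 1)%R) p0 (divr_gt0 p0 p10) pq1.
  rewrite -powRrM [X in (_ `^ X / (p / _))%R](_ : _ = p); last first.
    by field; rewrite gt_eqF.
  rewrite mulrC => /le_trans; apply.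
  rewrite le_eqVlt; apply/predU1P; left; rewrite /c; field; rewrite !gt_eqF//.
have : (l `^ p)%:E * mu A <=
    (p^-1)%:E * \int[mu]_(x in A) (g x `^ p) + c%:E * mu A.
  rewrite lpE EFinM -muleA.
  apply: (@le_trans _ _ ((l `^ (p - 1))%:E * \int[mu]_(x in A) g x)).
    by rewrite lee_pmul2l.
  have lp_ge0 : 0 <= (l `^ (p - 1))%:E by rewrite lee_fin ltW.
  have ip_ge0 : 0 <= (p^-1)%:E by rewrite lee_fin invr_ge0 ltW.
  have mgA : measurable_fun A g by exact: measurable_funTS.
  have mgpA : measurable_fun A (fun x => g x `^ p) by exact: measurable_funTS.
  rewrite -integral_cst// -!ge0_integralZl//; last first.
    by move=> x _; exact: poweR_ge0.
  rewrite -ge0_integralD//; last 2 first.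
  - by move=> x _; rewrite mule_ge0 ?poweR_ge0.
  - exact: measurable_funeM.
  apply: ge0_le_integral => //.
  - by move=> x _; rewrite mule_ge0.
  - exact: measurable_funeM.
  - by apply: emeasurable_funD => //; exact: measurable_funeM.
have : 0 <= \int[mu]_(x in A) (g x `^ p) by apply: integral_ge0 => x _; exact: poweR_ge0.
have : mu A \is a fin_num by exact: fin_num_measure.
have : 0 <= mu A by [].
case: (mu A) => // a; rewrite lee_fin => a0 _.
case: (\int[mu]_(x in A) _) => [G||]//; last by move=> _ _; exact: leey.
rewrite lee_fin => G0; rewrite -!EFinM -EFinD !lee_fin /c => h.
have ip0 : (0 < p^-1)%R by rewrite invr_gt0.
rewrite -(ler_pM2l ip0); lra.
Qed.
End weak_to_strong.

(** * Sigma-algebras and strong measurability *)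

(** The sub-sigma-algebras of the theorem are bare set systems on [Om], which
is possibly empty; their closure properties are derived from the axioms
instead of from a measurable structure. *)
Section sigma_algebra_closure.
Context {Om : Type} {G : set_system Om}.
Hypothesis hG : sigma_algebra setT G.

Lemma sigma_algebra_setC A : G A -> G (~` A).
Proof. by case: hG => _ h _ /h; rewrite setTD. Qed.

Lemma sigma_algebra_cst (P : Prop) : G [set w | P].
Proof.
have [p|p] := pselect P.
  rewrite (_ : [set _ | _] = ~` set0); last by rewrite setC0; apply/seteqP; split.
  by apply: sigma_algebra_setC; case: hG.
by rewrite (_ : [set _ | _] = set0); [case: hG|apply/seteqP; split].
Qed.

Lemma sigma_algebra_bigcup_nat (A : nat -> set Om) :
  (forall n, G (A n)) -> G (\bigcup_n A n).
Proof. by case: hG => _ _; exact. Qed.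

Lemma sigma_algebra_bigcap_nat (A : nat -> set Om) :
  (forall n, G (A n)) -> G (\bigcap_n A n).
Proof.
move=> GA; rewrite -[X in G X]setCK setC_bigcap.
by apply/sigma_algebra_setC/sigma_algebra_bigcup_nat => n; exact: sigma_algebra_setC.
Qed.

Lemma sigma_algebra_setU A B : G A -> G B -> G (A `|` B).
Proof.
move=> GA GB; rewrite -bigcup2E; apply: sigma_algebra_bigcup_nat => -[//|[//|n]].
by case: hG.
Qed.

Lemma sigma_algebra_setI A B : G A -> G B -> G (A `&` B).
Proof.
move=> GA GB; rewrite -[X in G X]setCK setCI.
by apply/sigma_algebra_setC/sigma_algebra_setU; exact: sigma_algebra_setC.
Qed.

Lemma sigma_algebra_setD A B : G A -> G B -> G (A `\` B).
Proof.
by move=> GA GB; rewrite setDE; apply: sigma_algebra_setI => //; exact: sigma_algebra_setC.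
Qed.

Lemma sigma_algebra_fin_bigcup (I : choiceType) (D : set I) (F : I -> set Om) :
  finite_set D -> (forall i, D i -> G (F i)) -> G (\bigcup_(i in D) F i).
Proof.
move=> Dfin GF; rewrite -bigsetU_fset_set// big_seq; elim/big_ind: _.
- by case: hG.
- exact: sigma_algebra_setU.
- by move=> i; rewrite in_fset_set ?inE//; exact: GF.
Qed.

End sigma_algebra_closure.

Section strong_measurability_closure.
Context {Om : Type} {R : realType} {G : set_system Om}.
Hypothesis hG : sigma_algebra setT G.

Lemma simple_fun_preimage {V : normedModType R} (s : Om -> V) (B : set V) :
  simple_fun G s -> G (s @^-1` B).
Proof.
case=> sfin sG; rewrite (_ : _ @^-1` _ =
    \bigcup_(v in range s `&` B) s @^-1` [set v]); last first.
  apply/seteqP; split=> w /=; last by case=> v [_ Bv] /= ->.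
  by move=> Bs; exists (s w) => //; split => //; exists w.
by apply: sigma_algebra_fin_bigcup => //; exact: finite_setIl.
Qed.

Lemma simple_fun_comp2 {V W U : normedModType R} (phi : V -> W -> U)
    (s : Om -> V) (t : Om -> W) :
  simple_fun G s -> simple_fun G t -> simple_fun G (fun w => phi (s w) (t w)).
Proof.
move=> [sfin sG] [tfin tG]; split.
  apply: sub_finite_set (finite_image2 phi sfin tfin) => _ [w _ <-] /=.
  by exists (s w); [exists w|exists (t w); [exists w|]].
move=> u; rewrite (_ : _ @^-1` _ =
    \bigcup_(v in range s) (s @^-1` [set v] `&` t @^-1` [set x | phi v x = u])).
  apply: sigma_algebra_fin_bigcup => // v _; apply: sigma_algebra_setI => //.
  exact: simple_fun_preimage.
apply/seteqP; split=> w /= => [<-|[v _ [<-]]//].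
by exists (s w) => //; exists w.
Qed.

Lemma simple_fun_cst {V : normedModType R} (v : V) : simple_fun G (fun=> v).
Proof.
split; first by apply: sub_finite_set (finite_set1 v) => _ [w _ <-].
by move=> u; exact: (sigma_algebra_cst hG (v = u)).
Qed.

Lemma simple_fun_indic (A : set Om) : G A ->
  simple_fun G (fun w => \1_A w : R^o).
Proof.
move=> GA; split.
  apply: (@sub_finite_set _ _ [set 0; 1]); last exact: finite_set2.
  by move=> _ [w _ <-]; rewrite indicE; case: (_ \in _); [right|left].
move=> u.
rewrite (_ : _ @^-1` _ = (A `&` [set w | 1 = u]) `|` (~` A `&` [set w | 0 = u])).
  by apply: sigma_algebra_setU => //; apply: sigma_algebra_setI => //;
    [exact: sigma_algebra_cst|exact: sigma_algebra_setC|exact: sigma_algebra_cst].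
apply/seteqP; split=> w /=.
  rewrite indicE; have [/set_mem Aw|/negP nAw] := boolP (w \in A); first by left.
  by right; split => // Aw; apply/nAw/mem_set.
by case=> -[Aw <-]; rewrite indicE; [rewrite mem_set|rewrite memNset].
Qed.

Lemma strongly_measurable_simple {V : normedModType R} (s : Om -> V) :
  simple_fun G s -> strongly_measurable G s.
Proof. by move=> Gs; exists (fun=> s); split => // w; exact: cvg_cst. Qed.

(** Continuity of [phi] is asked along sequences, the form in which the
limit theorems for sums, scalings and norms provide it. *)
Lemma strongly_measurable_comp2 {V W U : normedModType R} (phi : V -> W -> U)
    (f : Om -> V) (g : Om -> W) :
  (forall (a : nat -> V) (b : nat -> W) v w, a n @[n --> \oo] --> v ->
     b n @[n --> \oo] --> w -> phi (a n) (b n) @[n --> \oo] --> phi v w) ->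
  strongly_measurable G f -> strongly_measurable G g ->
  strongly_measurable G (fun w => phi (f w) (g w)).
Proof.
move=> cphi [s_ [Gs sf]] [t_ [Gt tg]].
exists (fun n w => phi (s_ n w) (t_ n w)); split.
  by move=> n; exact: simple_fun_comp2.
by move=> w; exact: cphi.
Qed.

Lemma strongly_measurableD {V : normedModType R} (f g : Om -> V) :
  strongly_measurable G f -> strongly_measurable G g ->
  strongly_measurable G (fun w => f w + g w).
Proof. by apply: strongly_measurable_comp2 => a b v w; exact: cvgD. Qed.

Lemma strongly_measurableZ {V : normedModType R} (k : R) (f : Om -> V) :
  strongly_measurable G f -> strongly_measurable G (fun w => k *: f w).
Proof.
move=> mf.
apply: (@strongly_measurable_comp2 V V V (fun x _ => k *: x) f f) => //.
by move=> a b v w av _; exact: cvgZr.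
Qed.

Lemma strongly_measurable_norm {V : normedModType R} (f : Om -> V) :
  strongly_measurable G f -> strongly_measurable G (fun w => `|f w| : R^o).
Proof.
move=> mf.
apply: (@strongly_measurable_comp2 V V R^o (fun x _ => `|x| : R^o) f f) => //.
by move=> a b v w av _; exact: cvg_norm.
Qed.

Lemma strongly_measurable_max0 (f : Om -> R^o) :
  strongly_measurable G f ->
  strongly_measurable G (fun w => Num.max (f w) 0 : R^o).
Proof.
move=> mf; rewrite (_ : (fun _ => _) = fun w => 2^-1 *: (f w + `|f w|) : R^o).
  apply: strongly_measurableZ; apply: strongly_measurableD => //.
  exact: strongly_measurable_norm.
by apply/funext => w; rewrite maxr_absE addr0 subr0 /GRing.scale/= mulrC.
Qed.

(** The limit exceeds [r] if and only if, for some [k], the approximants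
eventually exceed [r + 1/(k+1)]: a countable combination of sets of [G]. *)
Lemma strongly_measurable_gt (f : Om -> R^o) (r : R) :
  strongly_measurable G f -> G [set w | r < f w].
Proof.
move=> [s_ [Gs sf]].
rewrite (_ : [set w | r < f w] = \bigcup_k \bigcup_N \bigcap_n
    s_ (N + n)%N @^-1` [set x | r + k.+1%:R^-1 < x]).
  do 2!(apply: sigma_algebra_bigcup_nat => // ?).
  by apply: sigma_algebra_bigcap_nat => // ?; exact: simple_fun_preimage.
apply/seteqP; split=> w /=.
  move=> rf; have fr0 : 0 < f w - r by rewrite subr_gt0.
  have [k hk] : exists k : nat, r + k.+1%:R^-1 < f w.
    have [k _ hk] := near_infty_natSinv_lt (PosNum fr0).
    by exists k; rewrite -ltrBrDl; apply: hk => /=.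
  exists k => //; have /cvgr_gt/(_ _ hk)[N _ hN] := sf w.
  by exists N => // n _ /=; apply: hN; rewrite /= leq_addr.
case=> k _ [N _ hN].
have : r + k.+1%:R^-1 <= f w.
  rewrite leNgt; apply/negP => fk.
  have /cvgr_lt/(_ _ fk)[M _ hM] := sf w.
  have /= := hM (N + M)%N (leq_addl _ _).
  by have /= := hN M I => /lt_trans/[apply]; rewrite ltxx.
by apply: lt_le_trans; rewrite ltrDl invr_gt0.
Qed.

End strong_measurability_closure.

Lemma strongly_measurableS {Om : Type} {R : realType} {V : normedModType R}
    (G H : set_system Om) (f : Om -> V) :
  G `<=` H -> strongly_measurable G f -> strongly_measurable H f.
Proof.
move=> GH [s_ [Gs sf]]; exists s_; split => // n.
by have [sfin sG] := Gs n; split => // v; exact/GH/sG.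
Qed.

(** * The Bochner integral of simple functions *)

Section bochner_integral.
Context {d : measure_display} {Om : measurableType d} {R : realType}.
Variable mu : {finite_measure set Om -> \bar R}.

Let sa_measurable : sigma_algebra setT (@measurable d Om) :=
  @sigma_algebra_measurable d Om.

Lemma measurable_fun_of_strongly (f : Om -> R) :
  strongly_measurable measurable (f : Om -> R^o) -> measurable_fun setT f.
Proof.
move=> mf; apply: (measurability _ (RGenOInfty.measurableE R)) => _ [_ [r ->] <-].
rewrite setTI (_ : _ @^-1` _ = [set w | r < f w]).
  exact: (strongly_measurable_gt sa_measurable r mf).
by apply/seteqP; split => w /=; rewrite in_itv/= andbT.
Qed.

Lemma measurable_norm_strongly {V : normedModType R} (f : Om -> V) :
  strongly_measurable measurable f -> measurable_fun setT (fun w => (`|f w|)%:E).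
Proof.
move=> mf; apply/measurable_EFinP/measurable_fun_of_strongly.
exact: strongly_measurable_norm.
Qed.

Lemma strongly_measurableB {V : normedModType R} (f g : Om -> V) :
  strongly_measurable measurable f -> strongly_measurable measurable g ->
  strongly_measurable measurable (fun w => f w - g w).
Proof.
apply: (strongly_measurable_comp2 sa_measurable (phi := fun x y => x - y)).
by move=> a b v w; exact: cvgB.
Qed.

(** Integrals are decomposed along the fibers of a map [P] with finite range.
The index type of [P] is arbitrary, so that two simple functions can be
handled at once through the pair of their values. *)
Section fibers.
Context {I : choiceType} (P : Om -> I).
Hypothesis Pfin : finite_set (range P).
Hypothesis mP : forall i, measurable (P @^-1` [set i]).
Local Open Scope ereal_scope.

Let r : seq I := finmap.enum_fset (fset_set (range P)).

Lemma integral_fibers (A : set Om) (h : Om -> \bar R) : measurable A ->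
  measurable_fun A h -> (forall w, 0 <= h w) ->
  \int[mu]_(w in A) h w =
  \sum_(i <- r) \int[mu]_(w in A `&` P @^-1` [set i]) h w.
Proof.
move=> mA mh h0.
have AE : A = \big[setU/set0]_(i <- r) (A `&` P @^-1` [set i]).
  rewrite /r bigsetU_fset_set//; apply/seteqP; split=> w /=; last by case=> ? _ [].
  by move=> Aw; exists (P w) => //; exists w.
rewrite [in LHS]AE ge0_integral_bigsetU//.
- by move=> i; exact: measurableI.
- exact: finmap.fset_uniq.
- by move=> i j _ _ [w [[_ <-] [_ <-]]].
- by rewrite -AE.
Qed.

Lemma measure_fibers (A : set Om) : measurable A ->
  fine (mu A) = (\sum_(i <- r) fine (mu (A `&` P @^-1` [set i])))%R.
Proof.
move=> mA; have mI i : measurable (A `&` P @^-1` [set i]) by exact: measurableI.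
apply: EFin_inj; rewrite -sumEFin.
under [RHS]eq_bigr do rewrite fineK ?fin_num_measure//.
rewrite fineK ?fin_num_measure//.
have := integral_fibers mA (@measurable_cst _ _ _ _ A 1) (fun=> lee01).
rewrite integral_cst// mul1e => ->; apply: eq_bigr => i _.
by rewrite integral_cst// mul1e.
Qed.

End fibers.

End bochner_integral.
Section simple_integral.
Context {d : measure_display} {Om : measurableType d} {R : realType}.
Variable mu : {finite_measure set Om -> \bar R}.
Context {V : normedModType R}.

Lemma simple_integral_seq (A : set Om) (s : Om -> V) :
  simple_fun measurable s ->
  simple_integral mu A s =
  \sum_(v <- finmap.enum_fset (fset_set (range s)))
     fine (mu (A `&` s @^-1` [set v])) *: v.
Proof. by case=> sfin _; rewrite /simple_integral fsbig_finite. Qed.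

(** The integral of a simple function may be computed from any finite
partition that refines the one given by its values. *)
Lemma simple_integral_fibers {I : choiceType} (P : Om -> I) (sigma : I -> V)
    (A : set Om) :
  finite_set (range P) -> (forall i, measurable (P @^-1` [set i])) ->
  measurable A -> simple_fun measurable (sigma \o P) ->
  simple_integral mu A (sigma \o P) =
  \sum_(i <- finmap.enum_fset (fset_set (range P)))
     fine (mu (A `&` P @^-1` [set i])) *: sigma i.
Proof.
move=> Pfin mP mA ss; rewrite simple_integral_seq//.
set r := finmap.enum_fset (fset_set (range P)).
have [sfin ms] := ss.
transitivity (\sum_(v <- finmap.enum_fset (fset_set (range (sigma \o P))))
    \sum_(i <- r) (if sigma i == v then
      fine (mu (A `&` P @^-1` [set i])) *: v else 0)).
  apply: eq_bigr => v _.
  rewrite (measure_fibers mu Pfin mP (measurableI _ _ mA (ms v))) scaler_suml.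
  apply: eq_bigr => i _; case: eqVneq => [<-|iv].
    congr (fine (mu _) *: _); rewrite -setIA; congr (_ `&` _).
    by apply/seteqP; split => w /= => [[]//|->].
  rewrite (_ : _ `&` _ = set0) ?measure0 ?scale0r//.
  by apply/seteqP; split => // w [[_ /= e] wi]; rewrite -e wi eqxx in iv.
rewrite exchange_big/= big_seq [RHS]big_seq; apply: eq_bigr => i ir.
have : sigma i \in finmap.enum_fset (fset_set (range (sigma \o P))).
  move: ir; rewrite /r !in_fset_set// !inE => -[w _ <-].
  by exists w.
move=> sr; rewrite (bigD1_seq _ sr (finmap.fset_uniq _))/=.
by rewrite eqxx big1 ?addr0// => v; rewrite eq_sym => /negbTE ->.
Qed.

(** Both integrals are computed on the common refinement given by the pair
[(s, t)], where the triangle inequality applies term by term. *)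
Lemma simple_integral_dist (A : set Om) (s t : Om -> V) :
  measurable A -> simple_fun measurable s -> simple_fun measurable t ->
  ((`|simple_integral mu A s - simple_integral mu A t|)%:E <=
   \int[mu]_(w in A) (`|s w - t w|)%:E)%E.
Proof.
move=> mA ss st; have [sfin ms] := ss; have [tfin mt] := st.
pose P w : (V * V)%type := (s w, t w).
have Pfin : finite_set (range P).
  apply: sub_finite_set (finite_setX sfin tfin) => _ [w _ <-].
  by split; exists w.
have mP i : measurable (P @^-1` [set i]).
  rewrite (_ : _ @^-1` _ = s @^-1` [set i.1] `&` t @^-1` [set i.2]).
    exact: measurableI.
  by case: i => a b; apply/seteqP; split => w /=; rewrite /P => -[-> ->].
have mI i : measurable (A `&` P @^-1` [set i]) by exact: measurableI.
rewrite (simple_integral_fibers (sigma := fst) Pfin)//.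
rewrite (simple_integral_fibers (sigma := snd) Pfin)//.
have mst : measurable_fun setT (fun w => (`|s w - t w|)%:E : \bar R).
  by apply: measurable_norm_strongly; apply: strongly_measurableB;
    exact: strongly_measurable_simple.
rewrite (integral_fibers mu Pfin mP mA); last 2 first.
- exact: measurable_funTS.
- by move=> w; rewrite lee_fin.
rewrite -sumrB; apply: (@le_trans _ _ (\sum_(i <- finmap.enum_fset (fset_set (range P)))
   ((`|fine (mu (A `&` P @^-1` [set i])) *: i.1 -
      fine (mu (A `&` P @^-1` [set i])) *: i.2|)%:E))%E).
  by rewrite sumEFin lee_fin; exact: ler_norm_sum.
apply: lee_sum => i _; rewrite -scalerBr normrZ ger0_norm ?fine_ge0// mulrC EFinM.
rewrite fineK ?fin_num_measure// -integral_cst//.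
rewrite (eq_integral (fun w => (`|s w - t w|)%:E))// => w /set_mem[_ /= <-] //.
Qed.

End simple_integral.

(** * Bounds for the Bochner integral *)

Section bochner_integral_bounds.
Context {d : measure_display} {Om : measurableType d} {R : realType}.
Variable mu : {finite_measure set Om -> \bar R}.
Context {V : normedModType R}.
Implicit Types (A : set Om) (f g h s : Om -> V) (v : V).

Lemma integral_norm_triangle A f g h : measurable A ->
  strongly_measurable measurable f -> strongly_measurable measurable g ->
  strongly_measurable measurable h ->
  (\int[mu]_(w in A) (`|f w - h w|)%:E <=
   \int[mu]_(w in A) (`|f w - g w|)%:E + \int[mu]_(w in A) (`|g w - h w|)%:E)%E.
Proof.
move=> mA mf mg mh.
have m k l : strongly_measurable measurable k -> strongly_measurable measurable l ->
    measurable_fun A (fun w => (`|k w - l w|)%:E : \bar R).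
  move=> mk ml; apply: measurable_funTS.
  by apply: measurable_norm_strongly; apply: strongly_measurableB.
rewrite -ge0_integralD//; [|exact: m|exact: m].
apply: ge0_le_integral => //; [exact: m|by apply: emeasurable_funD; exact: m|].
by move=> w _; rewrite -EFinD lee_fin ler_distD.
Qed.

Lemma integral_norm_triangle0 A f g : measurable A ->
  strongly_measurable measurable f -> strongly_measurable measurable g ->
  (\int[mu]_(w in A) (`|f w|)%:E <=
   \int[mu]_(w in A) (`|f w - g w|)%:E + \int[mu]_(w in A) (`|g w|)%:E)%E.
Proof.
move=> mA mf mg.
have m0 : strongly_measurable measurable (fun _ : Om => 0 : V).
  by apply: strongly_measurable_simple; apply: simple_fun_cst;
    exact: sigma_algebra_measurable.
have := integral_norm_triangle mA mf mg m0.
by under eq_integral do rewrite subr0; under [X in (_ <= _ + X)%E]eq_integral do rewrite subr0.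
Qed.

(** Comparing with simple functions determines the integral up to
[\int_A |f - s|]; in particular it shows that the value does not depend on
the approximating sequence. *)
Lemma bochner_integral_dist A f s v : measurable A ->
  strongly_measurable measurable f -> simple_fun measurable s ->
  is_bochner_integral mu A f v ->
  ((`|v - simple_integral mu A s|)%:E <= \int[mu]_(w in A) (`|f w - s w|)%:E)%E.
Proof.
move=> mA mf ss [s_ [ss_ fs sv]].
set J := (\int[mu]_(w in A) (`|f w - s w|)%:E)%E.
have c1 : ((`|simple_integral mu A (s_ n) - simple_integral mu A s|)%:E : \bar R)
    @[n --> \oo] --> (`|v - simple_integral mu A s|)%:E.
  apply: cvg_EFin; first exact: nearW.
  by apply: cvg_norm; apply: cvgB => //; exact: cvg_cst.
have c2 : (\int[mu]_(w in A) (`|f w - s_ n w|)%:E + J)%E @[n --> \oo] --> (0 + J)%E.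
  by apply: cvgeD => //; exact: cvg_cst.
rewrite -[leRHS]add0e; apply: (lee_cvg_to c1 c2); apply: nearW => n.
apply: (le_trans (simple_integral_dist mu mA (ss_ n) ss)).
under [X in (_ <= X + _)%E]eq_integral do rewrite distrC.
by apply: integral_norm_triangle => //; exact: strongly_measurable_simple.
Qed.

(** For a function without Bochner integral the bound holds because the
default value is [0]. *)
Lemma bochner_integral_norm_le A f : measurable A ->
  strongly_measurable measurable f ->
  ((`|bochner_integral mu A f|)%:E <= \int[mu]_(w in A) (`|f w|)%:E)%E.
Proof.
move=> mA mf; rewrite /bochner_integral; case: xgetP => [v _ fv|_]; last first.
  by rewrite normr0; apply: integral_ge0.
have s0 : simple_fun measurable (fun _ : Om => 0 : V).
  by apply: simple_fun_cst; exact: sigma_algebra_measurable.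
have := bochner_integral_dist mA mf s0 fv.
rewrite {1}/simple_integral fsbig1 ?subr0//.
  by under eq_integral do rewrite subr0.
by move=> _ [w _ <-]; rewrite scaler0.
Qed.

End bochner_integral_bounds.

(** Completeness of [V] enters here only: the integrals of the approximants
form a Cauchy sequence by [simple_integral_dist]. *)
Lemma bochner_integralP {d : measure_display} {Om : measurableType d}
    {R : realType} (mu : {finite_measure set Om -> \bar R})
    {V : completeNormedModType R} (A : set Om) (f : Om -> V)
    (s_ : nat -> Om -> V) :
  measurable A -> strongly_measurable measurable f ->
  (forall n, simple_fun measurable (s_ n)) ->
  (\int[mu]_(w in A) (`|f w - s_ n w|)%:E)%E @[n --> \oo] --> 0%E ->
  is_bochner_integral mu A f (bochner_integral mu A f).
Proof.
move=> mA mf ss fs.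
pose x n := simple_integral mu A (s_ n).
suff /cvg_ex[v xv] : cvg (x n @[n --> \oo]).
  by apply: (xgetI 0 (x := v)); exists s_; split.
apply/cauchy_cvgP; apply: cauchy_exP => e e0.
have e20 : (0 < (e / 2)%:E)%E by rewrite lte_fin divr_gt0.
have /fine_cvgP[ffin] := fs.
move=> /cvgr0Pnorm_lt /(_ _ (divr_gt0 e0 (ltr0n _ 2))) flt.
near \oo => N.
pose J n := (\int[mu]_(w in A) (`|f w - s_ n w|)%:E)%E.
have small n : J n \is a fin_num -> `|fine (J n)| < e / 2 -> (J n < (e / 2)%:E)%E.
  move=> nfin; rewrite ger0_norm ?fine_ge0 ?integral_ge0//.
  by rewrite -lte_fin fineK.
have hN : (J N < (e / 2)%:E)%E by apply: small; near: N.
exists (x N); suff : \forall n \near \oo, ball (x N) e (x n) by [].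
near=> n.
have hn : (J n < (e / 2)%:E)%E by apply: small; near: n.
rewrite /= -ball_normE /= -lte_fin.
apply: (le_lt_trans (simple_integral_dist mu mA (ss N) (ss n))).
apply: (@le_lt_trans _ _ (\int[mu]_(w in A) (`|s_ N w - f w|)%:E +
   \int[mu]_(w in A) (`|f w - s_ n w|)%:E)%E).
  by apply: integral_norm_triangle => //; exact: strongly_measurable_simple.
under [X in (X + _ < _)%E]eq_integral do rewrite distrC.
by rewrite [e in ltRHS](splitr e) EFinD lteD.
Unshelve. all: by end_near. Qed.

(** * Conditional expectation decreases the integral of the norm *)

Section conditional_expectation.
Context {d : measure_display} {Om : measurableType d} {R : realType}.
Variable mu : {finite_measure set Om -> \bar R}.
Variable G : set_system Om.
Hypothesis hG : sigma_algebra setT G.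
Hypothesis Gm : G `<=` measurable.

Lemma simple_fun_measurable {V : normedModType R} (s : Om -> V) :
  simple_fun G s -> simple_fun measurable s.
Proof. by move=> [sfin sG]; split => // v; exact/Gm/sG. Qed.

(** A pointwise approximating sequence need not be dominated.  Replacing
[s_n] by [0] where [|s_n| > 2 |u|] keeps the pointwise limit, also where [u]
vanishes, and gives the integrable bound [3 |u|] on the errors.  The cut is
made along a set of [G], so the new functions are still [G]-simple. *)
Lemma strongly_measurable_L1_approx {V : normedModType R} (u : Om -> V) :
  strongly_measurable G u -> (\int[mu]_w (`|u w|)%:E < +oo)%E ->
  exists s_ : nat -> Om -> V, (forall n, simple_fun G (s_ n)) /\
    forall A, measurable A ->
      (\int[mu]_(w in A) (`|u w - s_ n w|)%:E)%E @[n --> \oo] --> 0%E.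
Proof.
move=> Gu ufin; have [s_ [Gs su]] := Gu.
pose B n := ~` [set w | 0 < `|s_ n w| + (-2) *: (`|u w| : R^o)].
have GB n : G (B n).
  apply: sigma_algebra_setC => //; apply: strongly_measurable_gt => //.
  apply: strongly_measurableD => //.
    by apply: strongly_measurable_norm => //; exact: strongly_measurable_simple.
  by apply: strongly_measurableZ => //; exact: strongly_measurable_norm.
pose t_ n w := (\1_(B n) w : R^o) *: s_ n w.
have BE n w : B n w <-> `|s_ n w| <= 2 * `|u w|.
  rewrite /B /=; split => [/negP|h]; first by rewrite -leNgt /GRing.scale/= mulNr subr_le0.
  by apply/negP; rewrite -leNgt /GRing.scale/= mulNr subr_le0.
have Gt n : simple_fun G (t_ n).
  apply: (simple_fun_comp2 hG (fun (x : R^o) (y : V) => x *: y)) => //.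
  exact: simple_fun_indic.
have tu n w : `|t_ n w| <= 2 * `|u w|.
  rewrite /t_ indicE; case: (boolP (w \in B n)) => [/set_mem/BE|_].
    by rewrite scale1r.
  by rewrite scale0r normr0 mulr_ge0.
have tcvg w : t_ n w @[n --> \oo] --> u w.
  have [u0|u0] := eqVneq (u w) 0.
    apply: cvg_near_cst; apply: nearW => n; apply/eqP; rewrite u0 -normr_le0.
    by apply: (le_trans (tu n w)); rewrite u0 normr0 mulr0.
  apply: cvg_trans (su w); apply: near_eq_cvg.
  have : `|u w| < 2 * `|u w| by rewrite ltr_pMl ?normr_gt0// ltr1n.
  move=> /(cvgr_lt _ (cvg_norm (su w))); apply: filterS => n sn.
  by rewrite /t_ indicE mem_set ?scale1r//; apply/BE/ltW.
exists t_; split => // A mA.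
have mu_ : strongly_measurable measurable u by exact: strongly_measurableS Gu.
have mt n : strongly_measurable measurable (t_ n).
  by apply: strongly_measurable_simple; exact: simple_fun_measurable.
have := @dominated_convergence _ _ _ mu A mA (fun n w => (`|u w - t_ n w|)%:E)
  (fun=> 0%E) (fun w => (3%:E * (`|u w|)%:E)%E).
case.
- move=> n; apply: measurable_funTS.
  by apply: measurable_norm_strongly; exact: strongly_measurableB.
- exact: measurable_cst.
- apply: nearW => w _; apply: cvg_EFin; first exact: nearW.
  have : (u w - t_ n w) @[n --> \oo] --> u w - u w.
    by apply: cvgB; [exact: cvg_cst|exact: tcvg].
  by rewrite subrr => /cvg_norm; rewrite normr0.
- apply/integrableP; split.
    apply/measurable_funeM/measurable_funTS; exact: measurable_norm_strongly.
  rewrite (eq_integral (fun w => (3%:E * (`|u w|)%:E)%E)); last first.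
    by move=> w _; rewrite gee0_abs// mule_ge0.
  rewrite ge0_integralZl//; last first.
    by apply/measurable_funTS/measurable_norm_strongly.
  rewrite lte_mul_pinfty//; apply: le_lt_trans ufin.
  by apply: ge0_subset_integral => //; exact: measurable_norm_strongly.
- apply: nearW => w n _; rewrite gee0_abs// -EFinM lee_fin.
  rewrite (le_trans (ler_normB _ _))// (_ : 3 = 1 + 2)// mulrDl mul1r.
  by rewrite lerD2l.
move=> _ _; rewrite integral0; exact.
Qed.

(** On a set [B] of [G] where a [G]-simple function [s] is constant,
[\int_B |s|] is the norm of the integral of [s] over [B], hence at most
[|\int_B u| + \int_B |u - s|], and [\int_B u = \int_B f].  Summing over
the values of [s] gives the claim up to [2 \int_A |u - s|], which is
arbitrarily small. *)
Lemma cond_expectation_norm_le {V : completeNormedModType R} (f u : Om -> V) :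
  strongly_measurable measurable f -> is_cond_expectation mu G f u ->
  forall A, G A -> (\int[mu]_(w in A) (`|u w|)%:E <= \int[mu]_(w in A) (`|f w|)%:E)%E.
Proof.
move=> mf [Gu ufin uf] A GA.
have {}ufin : (\int[mu]_w (`|u w|)%:E < +oo)%E.
  move: ufin; rewrite /Bnorm Lnorm1.
  by under eq_integral do rewrite gee0_abs//.
have mA := Gm GA.
have mu_ : strongly_measurable measurable u by exact: strongly_measurableS Gu.
have mnu : measurable_fun setT (fun w => (`|u w|)%:E : \bar R).
  exact: measurable_norm_strongly.
have [s_ [Gs su]] := strongly_measurable_L1_approx Gu ufin.
pose J n := (\int[mu]_(w in A) (`|u w - s_ n w|)%:E)%E.
suff key n : (\int[mu]_(w in A) (`|u w|)%:E <=
    J n + (\int[mu]_(w in A) (`|f w|)%:E + J n))%E.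
  have c : (J n + (\int[mu]_(w in A) (`|f w|)%:E + J n))%E @[n --> \oo] -->
      (0 + (\int[mu]_(w in A) (`|f w|)%:E + 0))%E.
    apply: cvgeD => //; first exact: su.
    apply: cvgeD => //; [|exact: cvg_cst|exact: su].
    by rewrite fin_num_adde_defl.
  rewrite add0e adde0 in c.
  by apply: (cvge_ge _ c); exact: nearW.
have ms := simple_fun_measurable (Gs n).
have mss := strongly_measurable_simple ms.
apply: (le_trans (integral_norm_triangle0 mu mA mu_ mss)); rewrite leeD2l//.
have [sfin sG] := Gs n.
have mB v : measurable (A `&` s_ n @^-1` [set v]) by apply: measurableI => //; exact/Gm/sG.
have mfib h : strongly_measurable measurable h ->
    (\int[mu]_(w in A) (`|h w|)%:E =
     \sum_(v <- finmap.enum_fset (fset_set (range (s_ n))))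
       \int[mu]_(w in A `&` s_ n @^-1` [set v]) (`|h w|)%:E)%E.
  move=> mh; apply: integral_fibers => //.
  - by move=> v; exact/Gm/sG.
  - exact/measurable_funTS/measurable_norm_strongly.
rewrite /J !mfib//; last exact: strongly_measurableB.
rewrite -big_split/= big_seq [leRHS]big_seq; apply: lee_sum => v vr.
set B := A `&` _.
have GB : G B by exact: sigma_algebra_setI.
have siB : simple_integral mu B (s_ n) = fine (mu B) *: v.
  rewrite simple_integral_seq// (bigD1_seq _ vr (finmap.fset_uniq _))/=.
  rewrite -setIA setIid big1 ?addr0// => x xv.
  rewrite (_ : _ `&` _ = set0) ?measure0 ?scale0r//.
  by apply/seteqP; split => // w [[_ /= sv] sx]; rewrite -sx sv eqxx in xv.
rewrite (eq_integral (fun=> (`|v|)%:E)); last by move=> w /set_mem[_ /= ->].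
rewrite integral_cst; last exact: mB.
have := bochner_integral_dist (mB v) mu_ ms
  (bochner_integralP (mB v) mu_ (fun n => simple_fun_measurable (Gs n)) (su _ (mB v))).
rewrite uf// siB => h.
apply: (@le_trans _ _ (`|bochner_integral mu B f| +
    `|bochner_integral mu B f - fine (mu B) *: v|)%:E).
  have -> : ((`|v|)%:E * mu B = (`|v| * fine (mu B))%:E)%E.
    by rewrite EFinM fineK ?fin_num_measure//; exact: mB.
  rewrite lee_fin.
  rewrite -[X in _ * X]ger0_norm ?fine_ge0// mulrC -normrZ distrC.
  by rewrite -[X in `|X| <= _](subrK (bochner_integral mu B f)) addrC ler_normD.
rewrite EFinD; apply: leeD; last exact: h.
by apply: bochner_integral_norm_le => //; exact: mB.
Qed.

End conditional_expectation.

(** * Doob's maximal inequality for a double family *)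

Section martingale_maximal.
Context {d : measure_display} {Om : measurableType d} {R : realType}.
Variable mu : {finite_measure set Om -> \bar R}.
Context {V : normedModType R}.

(** The disjoint pieces [seqDU B k], where [k] is the first index with
[|u k| > l], belong to [G k], so on each of them the integral of [|u k|],
which is at least [l] times the measure of the piece, is bounded by that of
[g]. *)
Lemma first_hitting_maximal (G : nat -> set_system Om) (u : nat -> Om -> V)
    (g : Om -> \bar R) (l : R) (K : nat) : 0 <= l ->
  (forall k, sigma_algebra setT (G k)) -> (forall k, G k `<=` measurable) ->
  (forall j k, (j <= k)%N -> G j `<=` G k) ->
  (forall k, strongly_measurable (G k) (u k)) ->
  measurable_fun setT g -> (forall w, 0 <= g w)%E ->
  (forall k A, G k A ->
     \int[mu]_(w in A) (`|u k w|)%:E <= \int[mu]_(w in A) g w)%E ->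
  let E := \big[setU/set0]_(k < K) [set w | l < `|u k w|] in
  (l%:E * mu E <= \int[mu]_(w in E) g w)%E.
Proof.
move=> l0 saG Gm Gle Gu mg g0 ug; lazy zeta; set E := \big[_/_]_(_ < _) _.
pose B k := [set w | l < `|u k w|].
have GB j k : (j <= k)%N -> G k (B j).
  move=> jk; apply: (Gle _ _ jk).
  exact: strongly_measurable_gt (strongly_measurable_norm (saG j) (Gu j)).
have GD k : G k (seqDU B k).
  apply: sigma_algebra_setD => //; first exact: GB.
  elim/big_ind: _ => [||i _]; [by case: (saG k)|exact: sigma_algebra_setU|].
  by apply: GB; exact: ltnW.
have mD k : measurable (seqDU B k) by exact/Gm/GD.
have -> : E = \big[setU/set0]_(k <- index_iota 0 K) seqDU B k.
  by rewrite big_mkord /E -bigsetU_seqDU.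
rewrite ge0_integral_bigsetU//; last 3 first.
- exact: iota_uniq.
- by apply: sub_trivIset (trivIset_seqDU B).
- exact: measurable_funTS.
rewrite !big_mkord measure_bigsetU// ge0_sume_distrr//.
apply: lee_sum => k _; rewrite -integral_cst//.
apply: le_trans (ug k _ (GD k)).
apply: ge0_le_integral => //.
- exact: measurable_funTS (measurable_norm_strongly (strongly_measurableS (Gm k) (Gu k))).
- by move=> w [/= lw _]; rewrite lee_fin ltW.
Qed.

Lemma sup_norm2_gt (h : nat -> nat -> Om -> V) (l : R) (w : Om) :
  (l%:E < sup_norm2 h w)%E <-> exists n1 n2, l < `|h n1.+1 n2.+1 w|.
Proof.
split.
  move=> /ereal_sup_gt[_ [n1 /= n10 [n2 /= n20 <-]]]; rewrite lte_fin => ln.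
  by exists n1.-1, n2.-1; rewrite !prednK.
move=> [n1 [n2 ln]]; apply: (@lt_le_trans _ _ (`|h n1.+1 n2.+1 w|)%:E).
  by rewrite lte_fin.
by apply: ereal_sup_ubound; exists n1.+1 => //; exists n2.+1.
Qed.

Definition exceeds_below (h : nat -> nat -> Om -> V) (l : R) (N : nat) : set Om :=
  [set w | exists n1 n2, [/\ (n1 < N)%N, (n2 < N)%N & l < `|h n1.+1 n2.+1 w|]].

(** The pairs of indices below [N] are enumerated by [k < N * N] with the
second index [sigma (k / N)] varying slowly, so that the sigma-algebras along
the enumeration are monotone.  The involution [sigma] is the identity for an
increasing family and the reversal for a decreasing one. *)
Lemma exceeds_below_bigsetU (h : nat -> nat -> Om -> V) (l : R) (N : nat)
    (sigma : nat -> nat) :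
  (forall q, (q < N)%N -> (sigma q < N)%N /\ sigma (sigma q) = q) ->
  exceeds_below h l N = \big[setU/set0]_(k < N * N)
    [set w | l < `|h (k %% N)%N.+1 (sigma (k %/ N)%N).+1 w|].
Proof.
move=> hs; pose B k := [set w | l < `|h (k %% N)%N.+1 (sigma (k %/ N)%N).+1 w|].
rewrite -(bigcup_mkord (N * N) B); apply/seteqP; split => w.
  move=> [n1 [n2 [n1N n2N ln]]]; have [sN ss] := hs _ n2N.
  have kN : (sigma n2 * N + n1 < N * N)%N.
    apply: (@leq_trans ((sigma n2).+1 * N)); first by rewrite mulSn addnC ltn_add2r.
    by rewrite leq_mul2r sN orbT.
  exists (sigma n2 * N + n1)%N => //=.
  have N0 : (0 < N)%N by exact: leq_ltn_trans n1N.
  by rewrite /B/= modnMDl modn_small// divnMDl// divn_small// addn0 ss.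
move=> [k /= kN ln].
have N0 : (0 < N)%N by case: (N) kN.
exists (k %% N)%N, (sigma (k %/ N)%N); split => //; first by rewrite ltn_mod.
by apply: (hs _ _).1; rewrite ltn_divLR.
Qed.

(** The reversal of a decreasing family requires a last index, so the weak
inequality is proved for indices below [N] and passes to the limit. *)
Lemma doob_maximal (F : nat -> set_system Om) (h : nat -> nat -> Om -> V)
    (g : Om -> \bar R) (l : R) : 0 <= l ->
  monotone_sub_sigma_algebras F ->
  (forall n1 n2, (0 < n1)%N -> (0 < n2)%N -> strongly_measurable (F n2) (h n1 n2)) ->
  measurable_fun setT g -> (forall w, 0 <= g w)%E ->
  (forall n1 n2 A, (0 < n1)%N -> (0 < n2)%N -> F n2 A ->
     \int[mu]_(w in A) (`|h n1 n2 w|)%:E <= \int[mu]_(w in A) g w)%E ->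
  let E := [set w | l%:E < sup_norm2 h w]%E in
  measurable E /\ (l%:E * mu E <= \int[mu]_(w in E) g w)%E.
Proof.
move=> l0 [saF monF] Fh mg g0 hg E.
have EE : E = \bigcup_N exceeds_below h l N.
  apply/seteqP; split => w.
    move=> /sup_norm2_gt[n1 [n2 ln]]; exists (maxn n1 n2).+1 => //.
    by exists n1, n2; rewrite !ltnS leq_maxl leq_maxr.
  by move=> [N _ [n1 [n2 [_ _ ln]]]]; apply/sup_norm2_gt; exists n1, n2.
have mh n1 n2 : measurable [set w | l < `|h n1.+1 n2.+1 w|].
  have [sa Fm] := saF n2.+1 isT.
  exact/Fm/(strongly_measurable_gt sa _ (strongly_measurable_norm sa (Fh _ _ _ _))).
have hN N : measurable (exceeds_below h l N) /\
    (l%:E * mu (exceeds_below h l N) <=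
     \int[mu]_(w in exceeds_below h l N) g w)%E.
  have [sigma hs Fs] : exists2 sigma : nat -> nat,
      (forall q, (q < N)%N -> (sigma q < N)%N /\ sigma (sigma q) = q) &
      forall j k, (j <= k)%N -> F (sigma j).+1 `<=` F (sigma k).+1.
    case: monF => monF; [exists id => //|exists (fun q => N.-1 - q)%N].
    - by move=> j k jk; apply: monF.
    - by move=> q qN; split; lia.
    - by move=> j k jk; apply: monF; lia.
  rewrite (exceeds_below_bigsetU h l hs); split.
    by apply: bigsetU_measurable => k _; exact: mh.
  apply: (@first_hitting_maximal (fun k => F (sigma (k %/ N)%N).+1)
    (fun k => h (k %% N)%N.+1 (sigma (k %/ N)%N).+1)) => //.
  - by move=> k; have [] := saF (sigma (k %/ N)%N).+1 isT.
  - by move=> k; have [] := saF (sigma (k %/ N)%N).+1 isT.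
  - by move=> j k jk; apply: Fs; exact: leq_div2r.
  - by move=> k; exact: Fh.
  - by move=> k A; exact: hg.
have mE : measurable E by rewrite EE; apply: bigcupT_measurable => N; exact: (hN N).1.
split => //.
have nd : {homo exceeds_below h l : n m / (n <= m)%N >-> (n <= m)%O}.
  move=> n m nm; apply/subsetPset => w [n1 [n2 [n1n n2n ln]]].
  by exists n1, n2; split => //; apply: leq_trans nm.
have c : (l%:E * mu (exceeds_below h l N))%E @[N --> \oo] --> (l%:E * mu E)%E.
  apply: cvgeZl => //; rewrite EE; apply: nondecreasing_cvg_mu => //.
    by move=> N; exact: (hN N).1.
  by rewrite -EE.
apply: (cvge_le _ c); apply: nearW => N; apply: (le_trans (hN N).2).
apply: ge0_subset_integral => //; [exact: (hN N).1|exact: measurable_funTS|].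
by rewrite EE; exact: bigcup_sup.
Qed.

End martingale_maximal.

(** * The space L_1 and its operators *)

Section L1_space.
Context {d : measure_display} {Om : measurableType d} {R : realType}.
Variable mu : {finite_measure set Om -> \bar R}.

Let saM : sigma_algebra setT (@measurable d Om) :=
  @sigma_algebra_measurable d Om.

Lemma Bnorm1E {V : normedModType R} (f : Om -> V) :
  Bnorm mu 1%:E f = (\int[mu]_w (`|f w|)%:E)%E.
Proof.
rewrite /Bnorm Lnorm1; apply: eq_integral => w _.
by rewrite gee0_abs.
Qed.

Lemma LB1P {V : normedModType R} (f : Om -> V) :
  LB mu 1%:E f <-> strongly_measurable measurable f /\
                   (\int[mu]_w (`|f w|)%:E < +oo)%E.
Proof. by rewrite -Bnorm1E. Qed.

Lemma LB1_le {V W : normedModType R} (f : Om -> V) (g : Om -> W) :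
  strongly_measurable measurable f -> LB mu 1%:E g ->
  (forall w, `|f w| <= `|g w|) -> LB mu 1%:E f.
Proof.
move=> mf /LB1P[mg gfin] fg; apply/LB1P; split => //.
apply: le_lt_trans gfin; apply: ge0_le_integral => //.
- exact: measurable_norm_strongly.
- exact: measurable_norm_strongly.
- by move=> w _; rewrite lee_fin.
Qed.

Lemma LB1D {V : normedModType R} (f g : Om -> V) :
  LB mu 1%:E f -> LB mu 1%:E g -> LB mu 1%:E (fun w => f w + g w).
Proof.
move=> /LB1P[mf ffin] /LB1P[mg gfin]; apply/LB1P.
have mfg := strongly_measurableD saM mf mg; split => //.
apply: (@le_lt_trans _ _ (\int[mu]_w ((`|f w|)%:E + (`|g w|)%:E))%E).
  apply: ge0_le_integral => //.
  - exact: measurable_norm_strongly.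
  - by apply: emeasurable_funD; exact: measurable_norm_strongly.
  - by move=> w _; rewrite -EFinD lee_fin ler_normD.
rewrite ge0_integralD//; [|exact: measurable_norm_strongly|exact: measurable_norm_strongly].
exact: lte_add_pinfty.
Qed.

Lemma LB1Z {V : normedModType R} (k : R) (f : Om -> V) :
  LB mu 1%:E f -> LB mu 1%:E (fun w => k *: f w).
Proof.
move=> /LB1P[mf ffin]; apply/LB1P; split; first exact: strongly_measurableZ.
under eq_integral do rewrite normrZ EFinM.
rewrite ge0_integralZl//; last exact: measurable_norm_strongly.
by rewrite lte_mul_pinfty.
Qed.

Lemma LB1_cst {V : normedModType R} (v : V) : LB mu 1%:E (fun _ : Om => v).
Proof.
apply/LB1P; split; first by apply: strongly_measurable_simple; exact: simple_fun_cst.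
by rewrite integral_cst// lte_mul_pinfty// ltey_eq fin_num_measure.
Qed.

Lemma LB1_norm {V : normedModType R} (f : Om -> V) :
  LB mu 1%:E f -> LB mu 1%:E (fun w => `|f w| : R^o).
Proof.
move=> Lf; apply: (LB1_le _ Lf) => [|w]; last by rewrite normr_id.
by apply: strongly_measurable_norm => //; exact: Lf.1.
Qed.

Lemma LB1_max0 (f : Om -> R^o) :
  LB mu 1%:E f -> LB mu 1%:E (fun w => Num.max (f w) 0 : R^o).
Proof.
move=> Lf; apply: (LB1_le _ Lf) => [|w].
  by apply: strongly_measurable_max0 => //; exact: Lf.1.
rewrite ger0_norm ?le_max ?lexx ?orbT//.
by rewrite ge_max ler_norm normr_ge0.
Qed.

End L1_space.

Section L1_operators.
Context {d : measure_display} {Om : measurableType d} {R : realType}.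
Variable mu : {finite_measure set Om -> \bar R}.

Lemma L1_operatorD {V : normedModType R} (T : (Om -> V) -> (Om -> V)) f g :
  L1_operator mu T -> LB mu 1%:E f -> LB mu 1%:E g ->
  {ae mu, forall w, T (fun w' => f w' + g w') w = T f w + T g w}.
Proof.
move=> [_ _ lin] Lf Lg; have := lin 1 f g Lf Lg; apply: filterS => w.
rewrite scale1r => <-; congr (T _ w); apply/funext => w'; by rewrite scale1r.
Qed.

Lemma L1_operator0 {V : normedModType R} (T : (Om -> V) -> (Om -> V)) :
  L1_operator mu T -> {ae mu, forall w, T (fun _ : Om => 0 : V) w = 0}.
Proof.
move=> hT; have L0 := @LB1_cst _ _ _ mu V 0.
have := L1_operatorD hT L0 L0; apply: filterS => w.
under [X in T X]eq_fun do rewrite addr0.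
by move=> /eqP; rewrite -subr_eq subrr => /eqP.
Qed.

Lemma L1_operatorZ {V : normedModType R} (T : (Om -> V) -> (Om -> V)) (k : R) f :
  L1_operator mu T -> LB mu 1%:E f ->
  {ae mu, forall w, T (fun w' => k *: f w') w = k *: T f w}.
Proof.
move=> hT Lf; have [_ _ lin] := hT; have L0 := @LB1_cst _ _ _ mu V 0.
have := lin k f _ Lf L0; apply: filterS2 (L1_operator0 hT) => w T0.
by under [X in T X]eq_fun do rewrite addr0; rewrite T0 addr0.
Qed.

Lemma positive_operator_le (T' : (Om -> R^o) -> (Om -> R^o)) f g :
  L1_operator mu T' -> positive_operator mu T' ->
  LB mu 1%:E f -> LB mu 1%:E g ->
  {ae mu, forall w, f w <= g w :> R} -> {ae mu, forall w, T' f w <= T' g w :> R}.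
Proof.
move=> hT' pos Lf Lg fg; have [_ _ lin] := hT'.
have := pos _ (LB1D (LB1Z (-1) Lf) Lg).
have gf : {ae mu, forall w, (0 : R) <= (-1) *: f w + g w}.
  by apply: filterS fg => w; rewrite scaleN1r addrC subr_ge0.
move=> /(_ gf); apply: filterS2 (lin (-1) f g Lf Lg) => w ->.
by rewrite scaleN1r addrC subr_ge0.
Qed.

(** The norm on [L_oo] is [0] by convention when [mu] vanishes, a case in
which every statement holds almost everywhere. *)
Lemma Loo_contraction1 (T' : (Om -> R^o) -> (Om -> R^o)) :
  L1_Loo_contraction mu T' -> {ae mu, forall w, T' (fun _ : Om => 1 : R^o) w <= 1 :> R}.
Proof.
move=> [_ /(_ _ (@LB1_cst _ _ _ mu R^o 1))]; rewrite /Bnorm unlock.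
case: ifPn => [mu0|]; last first.
  rewrite -leNgt measure_le0 => /eqP mu0 _.
  by exists setT; split.
move=> h; have /ess_supP : (ess_sup mu
    (abse \o (fun w => (`|T' (fun _ : Om => 1 : R^o) w|)%:E)) <= 1)%E.
  apply: (le_trans h); apply/ess_supP; apply: nearW => w /=.
  by rewrite !normr1.
apply: filterS => w /=; rewrite normr_id lee_fin.
exact: le_trans (ler_norm _).
Qed.

End L1_operators.

(** * The maximal ergodic inequality *)

Section hopf.
Context {d : measure_display} {Om : measurableType d} {R : realType}.
Variable mu : {finite_measure set Om -> \bar R}.
Variable T' : (Om -> R^o) -> (Om -> R^o).
Hypothesis hT' : L1_operator mu T'.
Hypothesis posT' : positive_operator mu T'.
Hypothesis conT' : L1_contraction mu T'.

(** Built by a recursion on positive parts instead of as the maximum of the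
partial sums of [T'^i psi]; it dominates those sums almost everywhere, and the
recursion makes
both the monotonicity in [n] and [M_(n+1) = psi + T' M_n] on
[{M_(n+1) > 0}] immediate. *)
Fixpoint hopf_max (psi : Om -> R^o) (n : nat) : Om -> R^o :=
  if n is n'.+1 then fun w => Num.max (psi w + T' (hopf_max psi n') w) 0
  else fun=> 0.

Variable psi : Om -> R^o.
Hypothesis Lpsi : LB mu 1%:E psi.
Let M := hopf_max psi.

Lemma LB1_hopf_max n : LB mu 1%:E (M n).
Proof.
elim: n => [|n LM]; first exact: LB1_cst.
by apply: LB1_max0; apply: LB1D => //; have [h _ _] := hT'; exact: h.
Qed.

Lemma hopf_max_ge0 n w : 0 <= M n w.
Proof. by case: n => [//|n]; rewrite /M/= le_max lexx orbT. Qed.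

Lemma hopf_max_leS n : {ae mu, forall w, M n w <= M n.+1 w :> R}.
Proof.
elim: n => [|n]; first by apply: nearW => w; exact: hopf_max_ge0.
move=> /(positive_operator_le hT' posT' (LB1_hopf_max n) (LB1_hopf_max n.+1)).
apply: filterS => w TM; rewrite /M/= ge_max !le_max lexx orbT andbT.
by rewrite lerD2l TM.
Qed.

Lemma hopf_max_le m n : (m <= n)%N -> {ae mu, forall w, M m w <= M n w :> R}.
Proof.
elim: n => [|n IH]; first by rewrite leqn0 => /eqP ->; exact: nearW.
rewrite leq_eqVlt => /predU1P[->|/IH]; first exact: nearW.
by apply: filterS2 (hopf_max_leS n) => w; move=> h1 h2; exact: le_trans h1.
Qed.

Definition hopf_set n : set Om := [set w | (0 : R) < M n w].

Lemma measurable_hopf_set n : measurable (hopf_set n).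
Proof.
apply: strongly_measurable_gt; first exact: sigma_algebra_measurable.
by have [] := LB1_hopf_max n.
Qed.

(** Hopf's maximal ergodic theorem for [psi = phi - l], written with
nonnegative integrals.  On [E = {M_(n+1) > 0}] one has
[M_(n+1) + l <= phi + T' M_(n+1)]; integrate over [E] and cancel
[\int_E M_(n+1)], which is the whole norm of [M_(n+1)] and hence bounds
[\int_E |T' M_(n+1)|]. *)
Lemma hopf_maximal (phi : Om -> R^o) (l : R) n : 0 <= l ->
  LB mu 1%:E phi -> (forall w, 0 <= phi w :> R) ->
  (forall w, psi w = phi w - l) ->
  (l%:E * mu (hopf_set n) <= \int[mu]_(w in hopf_set n) (phi w)%:E)%E.
Proof.
move=> l0 Lphi phi0 psiE.
case: n => [|n].
  rewrite (_ : hopf_set 0 = set0); last first.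
    by apply/seteqP; split => w//=; rewrite /hopf_set/= ltxx.
  by rewrite measure0 mule0 integral_set0.
set E := hopf_set n.+1.
have mE : measurable E by exact: measurable_hopf_set.
have LM k := LB1_hopf_max k.
have [LT _ _] := hT'.
have mR (k : Om -> R^o) : LB mu 1%:E k -> measurable_fun setT (fun w => (k w : R)%:E : \bar R).
  by move=> [mk _]; apply/measurable_EFinP; exact: measurable_fun_of_strongly.
have mN (k : Om -> R^o) : LB mu 1%:E k -> measurable_fun setT (fun w => (`|k w| : R)%:E : \bar R).
  by move=> [mk _]; exact: measurable_norm_strongly.
pose I := (\int[mu]_(w in E) (M n.+1 w : R)%:E)%E.
have I0 : (0 <= I)%E by apply: integral_ge0 => w _; rewrite lee_fin hopf_max_ge0.
have IE : I = (\int[mu]_w (`|M n.+1 w|)%:E)%E.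
  rewrite /I integral_mkcond; apply: eq_integral => w _; rewrite patchE.
  rewrite ger0_norm ?hopf_max_ge0//; case: ifPn => // /negP nE.
  congr (_%:E); apply/le_anti; rewrite hopf_max_ge0/= leNgt; apply/negP => ME.
  by apply: nE; rewrite inE.
have Ifin : I \is a fin_num.
  by rewrite ge0_fin_numE// IE; have /LB1P[] := LM n.+1.
have TI : (\int[mu]_(w in E) (`|T' (M n.+1) w|)%:E <= I)%E.
  rewrite IE; apply: (@le_trans _ _ (\int[mu]_w (`|T' (M n.+1) w|)%:E)%E).
    apply: ge0_subset_integral => //; apply: mN; exact: LT.
  by have := conT' (LM n.+1); rewrite !Bnorm1E.
have TM := positive_operator_le hT' posT' (LM n) (LM n.+1) (hopf_max_leS n).
have key : (I + l%:E * mu E <= \int[mu]_(w in E) (phi w : R)%:E + I)%E.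
  apply: (@le_trans _ _ (\int[mu]_(w in E) (phi w : R)%:E +
      \int[mu]_(w in E) (`|T' (M n.+1) w|)%:E)%E); last by rewrite leeD2l.
  rewrite -integral_cst//.
  have mM : measurable_fun E (fun w => (M n.+1 w : R)%:E : \bar R).
    exact/measurable_funTS/mR.
  have mp : measurable_fun E (fun w => (phi w : R)%:E : \bar R).
    exact/measurable_funTS/mR.
  have mT : measurable_fun E (fun w => (`|T' (M n.+1) w| : R)%:E : \bar R).
    exact/measurable_funTS/mN/LT.
  have M0 w : E w -> (0 <= (M n.+1 w : R)%:E)%E by rewrite lee_fin hopf_max_ge0.
  have p0 w : E w -> (0 <= (phi w : R)%:E)%E by rewrite lee_fin.
  have T0 w : E w -> (0 <= (`|T' (M n.+1) w| : R)%:E)%E by rewrite lee_fin.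
  have c0 w : E w -> (0 <= cst l%:E w)%E by rewrite lee_fin.
  rewrite -(ge0_integralD mu mE M0 mM c0 (@measurable_cst _ _ _ _ E l%:E)).
  rewrite -(ge0_integralD mu mE p0 mp T0 mT).
  apply: ae_ge0_le_integral => //.
  - by move=> w Ew; rewrite adde_ge0 ?M0 ?c0.
  - exact: emeasurable_funD.
  - by move=> w Ew; rewrite adde_ge0 ?p0 ?T0.
  - exact: emeasurable_funD.
  apply: filterS TM => w TMw Mpos.
  have MS : M n.+1 w = psi w + T' (M n) w.
    move: Mpos; rewrite /E /hopf_set /M/= lt_max ltxx orbF => Mpos.
    by rewrite max_l// ltW.
  rewrite -!EFinD lee_fin MS psiE addrAC subrK lerD2l.
  exact: le_trans TMw (ler_norm _).
by move: key; rewrite addeC leeD2rE.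
Qed.

End hopf.

Section ergodic_maximal.
Context {d : measure_display} {Om : measurableType d} {R : realType}.
Variable mu : {finite_measure set Om -> \bar R}.
Context {V : normedModType R}.
Variables (T : (Om -> V) -> (Om -> V)) (T' : (Om -> R^o) -> (Om -> R^o)).
Hypothesis hT : L1_operator mu T.
Hypothesis dom : positive_dominant mu T T'.
Hypothesis hT' : L1_Loo_contraction mu T'.
Variable f : Om -> V.
Hypothesis Lf : LB mu 1%:E f.

Definition ergodic_sum n : Om -> V := fun w => \sum_(i < n) iter i T f w.

Lemma LB1_iter n : LB mu 1%:E (iter n T f).
Proof. by elim: n => //= n; have [h _ _] := hT; exact: h. Qed.

Lemma LB1_ergodic_sum n : LB mu 1%:E (ergodic_sum n).
Proof.
elim: n => [|n IH].
  rewrite (_ : ergodic_sum 0 = fun=> 0); first exact: LB1_cst.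
  by apply/funext => w; rewrite /ergodic_sum big_ord0.
rewrite (_ : ergodic_sum n.+1 = fun w => ergodic_sum n w + iter n T f w).
  by apply: LB1D => //; exact: LB1_iter.
by apply/funext => w; rewrite /ergodic_sum big_ord_recr.
Qed.

(** The sums are peeled from the front, to match the recursion that defines
[hopf_max]. *)
Lemma ergodic_sumS n :
  {ae mu, forall w, ergodic_sum n.+1 w = f w + T (ergodic_sum n) w}.
Proof.
elim: n => [|n IH].
  rewrite (_ : ergodic_sum 0 = fun=> 0); last first.
    by apply/funext => w; rewrite /ergodic_sum big_ord0.
  apply: filterS (L1_operator0 hT) => w ->.
  by rewrite /ergodic_sum big_ord1 addr0.
rewrite [in X in T X](_ : ergodic_sum n.+1 =
    fun w => ergodic_sum n w + iter n T f w); last first.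
  by apply/funext => w; rewrite /ergodic_sum big_ord_recr.
have := L1_operatorD hT (LB1_ergodic_sum n) (LB1_iter n).
apply: filterS2 IH => w IH ->.
by rewrite addrA -IH {1}/ergodic_sum big_ord_recr.
Qed.

Let phi : Om -> R^o := fun w => `|f w|.
Let Lphi : LB mu 1%:E phi. Proof. exact: LB1_norm. Qed.

Variable l : R.
Hypothesis l0 : 0 <= l.
Let psi : Om -> R^o := fun w => phi w - l.
Let Lpsi : LB mu 1%:E psi.
Proof. by apply: (LB1D Lphi (LB1_cst mu (- l : R^o))). Qed.

Let T'op : L1_operator mu T'. Proof. by case: dom. Qed.
Let T'pos : positive_operator mu T'. Proof. by case: dom. Qed.
Let T'con : L1_contraction mu T'. Proof. by case: dom. Qed.

(** In the induction step [|f + T Q| <= |f| + T' |Q|] and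
[T' (M_n + n l) <= T' M_n + n l], because [T' 1 <= 1]; one more [l] is
absorbed by [psi = |f| - l]. *)
Lemma ergodic_sum_le_hopf_max n :
  {ae mu, forall w, `|ergodic_sum n w| <= hopf_max T' psi n w + n%:R * l}.
Proof.
elim: n => [|n IH].
  by apply: nearW => w; rewrite /ergodic_sum big_ord0 normr0 mul0r addr0.
have LQ := LB1_norm (LB1_ergodic_sum n).
have LM := LB1_hopf_max T'op Lpsi n.
have Lc := @LB1_cst _ _ _ mu R^o 1.
have Lnl := LB1Z (n%:R * l) Lc.
have IH' : {ae mu, forall w, (`|ergodic_sum n w| : R^o) <=
     hopf_max T' psi n w + (n%:R * l) *: (1 : R^o) :> R}.
  by apply: filterS IH => w; rewrite [_ *: _]mulr1.
have [_ _ _ TT'] := dom.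
have Tsplit := L1_operatorD T'op LM Lnl.
have T1 : {ae mu, forall w, T' (fun w' => (n%:R * l) *: (1 : R^o)) w <= n%:R * l :> R}.
  have := Loo_contraction1 hT'; apply: filterS2 (L1_operatorZ (n%:R * l) T'op Lc) => w ->.
  by move=> T1; rewrite -[leRHS]mulr1 ler_wpM2l// mulr_ge0.
apply: filterS2 (filterI (filterI (ergodic_sumS n) (TT' _ (LB1_ergodic_sum n)))
  (positive_operator_le T'op T'pos LQ (LB1D LM Lnl) IH')) (filterI Tsplit T1).
move=> w [[h1 h2] h3] [h4 h5].
rewrite h1; apply: (le_trans (ler_normD _ _)).
apply: (@le_trans _ _ (psi w + T' (hopf_max T' psi n) w + n.+1%:R * l)); last first.
  by rewrite lerD2r /= le_max lexx.
rewrite /psi -[n.+1%:R]natr1 mulrDl mul1r.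
rewrite (_ : _ - l + _ + _ = phi w + (T' (hopf_max T' psi n) w + n%:R * l)); last by ring.
rewrite /phi lerD2l; apply: (le_trans h2); apply: (le_trans h3); rewrite h4.
by rewrite lerD2l.
Qed.

Lemma ergodic_meanE n w : ergodic_mean T n f w = n%:R^-1 *: ergodic_sum n w.
Proof. by []. Qed.

Lemma strongly_measurable_ergodic_mean n :
  strongly_measurable measurable (ergodic_mean T n f).
Proof.
apply: strongly_measurableZ; first exact: sigma_algebra_measurable.
by have [] := LB1_ergodic_sum n.
Qed.

Lemma ergodic_mean1 w : ergodic_mean T 1 f w = f w.
Proof. by rewrite ergodic_meanE /ergodic_sum big_ord1 invr1 scale1r. Qed.

Lemma sup_norm_gt (h : nat -> Om -> V) (r : R) w :
  (r%:E < sup_norm h w)%E <-> exists n, r < `|h n.+1 w|.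
Proof.
split.
  move=> /ereal_sup_gt[_ [n /= n0 <-]]; rewrite lte_fin => ln.
  by exists n.-1; rewrite prednK.
move=> [n ln]; apply: (@lt_le_trans _ _ (`|h n.+1 w|)%:E); first by rewrite lte_fin.
by apply: ereal_sup_ubound; exists n.+1.
Qed.

(** Hopf's inequality holds on sets [E N] that cover [{g > l}], where [g] is
the maximal function.  It restricts to [E N `&` {g > l}], since
[|f| <= g <= l] on the rest of [E N]. *)
Lemma ergodic_maximal :
  (l%:E * mu [set w | l%:E < sup_norm (fun n => ergodic_mean T n f) w] <=
   \int[mu]_(w in [set w | l%:E < sup_norm (fun n => ergodic_mean T n f) w])
     (`|f w|)%:E)%E.
Proof.
set A := [set w | _].
pose B n := [set w | l < `|ergodic_mean T n.+1 f w|].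
have mB n : measurable (B n).
  apply: strongly_measurable_gt; first exact: sigma_algebra_measurable.
  apply: strongly_measurable_norm; first exact: sigma_algebra_measurable.
  exact: strongly_measurable_ergodic_mean.
have AE : A = \bigcup_n B n.
  apply/seteqP; split => w; first by move=> /sup_norm_gt[n ln]; exists n.
  by move=> [n _ ln]; apply/sup_norm_gt; exists n.
have mA : measurable A by rewrite AE; exact: bigcupT_measurable.
have phiA w : ~ A w -> `|f w| <= l.
  rewrite -ergodic_mean1 => nA; rewrite leNgt; apply/negP => lf; apply: nA.
  by apply/sup_norm_gt; exists 0%N.
have mphi : measurable_fun setT (fun w => (`|f w|)%:E : \bar R).
  by apply: measurable_norm_strongly; case: Lf.
pose C N := \big[setU/set0]_(n < N) B n.
have mC N : measurable (C N) by exact: bigsetU_measurable.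
pose E N := hopf_set T' psi N.
have mE N : measurable (E N) by exact: (measurable_hopf_set T'op Lpsi).
have hE N : (l%:E * mu (E N) <= \int[mu]_(w in E N) (`|f w|)%:E)%E.
  by apply: (hopf_maximal T'op T'pos T'con Lpsi N l0 Lphi) => // w; exact: normr_ge0.
(* up to a null set: the functions hopf_max increase with n only almost
   everywhere *)
have CE N : \forall w \ae mu, C N w -> E N w.
  have Mle : \forall w \ae mu, forall n, (n <= N)%N ->
      hopf_max T' psi n w <= hopf_max T' psi N w :> R.
    apply: ae_foralln => n; have [nN|Nn] := leqP n N; last exact: nearW.
    by apply: filterS (hopf_max_le T'op T'pos Lpsi nN).
  apply: filterS2 Mle (ae_foralln ergodic_sum_le_hopf_max) => w Mle Qle.
  rewrite /C -bigcup_mkord => -[n /= nN].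
  rewrite /B/= ergodic_meanE normrZ ger0_norm ?invr_ge0//.
  rewrite mulrC ltr_pdivlMr// mulrC => lQ.
  rewrite /E /hopf_set/=; apply: lt_le_trans (Mle n.+1 nN).
  rewrite -(ltrD2r (n.+1%:R * l)) add0r; exact: lt_le_trans lQ (Qle n.+1).
(* the integral of |f| over the discarded part is at most l times its
   measure, which cancels *)
have hEA N : (l%:E * mu (E N `&` A) <= \int[mu]_(w in A) (`|f w|)%:E)%E.
  apply: (@le_trans _ _ (\int[mu]_(w in E N `&` A) (`|f w|)%:E)%E); last first.
    apply: ge0_subset_integral => //; first exact: measurableI.
    exact: measurable_funTS.
  have mD : measurable (E N `\` A) by exact: measurableD.
  have mI : measurable (E N `&` A) by exact: measurableI.
  have := hE N.
  rewrite -[in X in (X <= _)%E -> _](setUIDK (E N) A).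
  rewrite -[in X in (_ <= X)%E -> _](setUIDK (E N) A).
  have dis : [disjoint E N `&` A & E N `\` A].
    by apply/disj_setPS => w [[_ Aw] [_]].
  rewrite measureU//; last by apply/disj_set2P.
  rewrite ge0_integral_setU//; last exact: measurable_funTS.
  rewrite ge0_muleDr// => h.
  have lD : (l%:E * mu (E N `\` A) \is a fin_num)%E.
    by rewrite fin_numM// fin_num_measure.
  rewrite -(leeD2rE _ _ lD); apply: (le_trans h); rewrite leeD2l//.
  rewrite -integral_cst//; apply: ge0_le_integral => //.
  - exact: measurable_funTS.
  - by move=> w [_ /phiA]; rewrite lee_fin.
have hCA N : (l%:E * mu (C N) <= \int[mu]_(w in A) (`|f w|)%:E)%E.
  apply: le_trans (hEA N); apply: lee_pmul => //.
  have mI : measurable (E N `&` A) by exact: measurableI.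
  have muE D : measurable D -> mu D = (\int[mu]_w (\1_D w)%:E)%E.
    by move=> mD; rewrite integral_indic// setIT.
  rewrite (muE _ (mC N)) (muE _ mI); apply: ae_ge0_le_integral => //.
  - by apply/measurable_EFinP.
  - by apply/measurable_EFinP.
  apply: filterS (CE N) => w CEw _; rewrite lee_fin !indicE.
  have [/set_mem Cw|_] := boolP (w \in C N); last by [].
  rewrite mem_set//; split; first exact: CEw.
  rewrite AE; move: Cw; rewrite /C -bigcup_mkord => -[n _ Bn]; by exists n.
have c : (l%:E * mu (C N))%E @[N --> \oo] --> (l%:E * mu A)%E.
  apply: cvgeZl => //.
  have CA : \bigcup_N C N = A.
    rewrite AE; apply/seteqP; split => w.
      by move=> [N _]; rewrite /C -bigcup_mkord => -[n _ Bn]; exists n.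
    move=> [n _ Bn]; exists n.+1 => //; rewrite /C -bigcup_mkord.
    by exists n => /=.
  rewrite -CA; apply: nondecreasing_cvg_mu => //; first by rewrite CA.
  move=> n m nm; apply/subsetPset; rewrite /C -!bigcup_mkord => w [k /= kn Bk].
  by exists k => //=; exact: leq_trans nm.
by apply: (cvge_le _ c); apply: nearW.
Qed.

End ergodic_maximal.

(** * The double maximal theorem *)

Section assembly.
Context {d : measure_display} {Om : measurableType d} {R : realType}.
Variable mu : {finite_measure set Om -> \bar R}.

Lemma measurable_fun_superlevel (M : Om -> \bar R) : (forall w, 0 <= M w)%E ->
  (forall l : R, 0 <= l -> measurable [set w | l%:E < M w]%E) ->
  measurable_fun setT M.
Proof.
move=> M0 mM; apply: (measurability _ (ErealGenOInfty.measurableE R)) => _ [_ [r ->] <-].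
rewrite setTI (_ : _ @^-1` _ = [set w | r%:E < M w]%E); last first.
  by apply/seteqP; split => w /=; rewrite in_itv/= andbT.
have [r0|r0] := leP 0 r; first exact: mM.
rewrite (_ : [set _ | _] = setT)//; apply/seteqP; split => w // _ /=.
by apply: lt_le_trans (M0 w); rewrite lte_fin.
Qed.

Lemma Bnorm_poweR {V : normedModType R} (p : R) (f : Om -> V) : p != 0 ->
  (Bnorm mu p%:E f `^ p = \int[mu]_w ((`|f w|)%:E `^ p))%E.
Proof.
move=> p0; rewrite /Bnorm poweR_Lnorm//; apply: eq_integral => w _.
by rewrite gee0_abs.
Qed.

Lemma LB_sub_LB1 {V : normedModType R} (p : R) (f : Om -> V) : 1 < p ->
  LB mu p%:E f -> LB mu 1%:E f.
Proof.
move=> p1 [mf ffin]; apply/LB1P; split => //.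
have p0 : 0 < p by exact: lt_trans p1.
have fpfin : (\int[mu]_w ((`|f w|)%:E `^ p) < +oo)%E.
  by rewrite -Bnorm_poweR ?gt_eqF//; exact: poweR_lty.
have mnf := measurable_norm_strongly mf.
have mfp : measurable_fun setT (fun w => (`|f w|)%:E `^ p)%E.
  exact: (measurableT_comp (measurable_poweR _)).
apply: (@le_lt_trans _ _ (\int[mu]_w (1 + (`|f w|)%:E `^ p))%E).
  apply: ge0_le_integral => //; first exact: emeasurable_funD.
  move=> w _; rewrite poweR_EFin -EFinD lee_fin.
  have [f1|/ltW f1] := leP `|f w| 1; first by rewrite (le_trans f1)// lerDl powR_ge0.
  by rewrite (le_trans (le1r_powR f1 (ltW p1)))// lerDr.
rewrite ge0_integralD//; last by move=> w _; exact: poweR_ge0.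
rewrite integral_cst// mul1e lte_add_pinfty//.
by rewrite ltey_eq fin_num_measure.
Qed.

End assembly.

Theorem theorem2p7 (R : realType) (X : completeNormedModType R)
  (d : measure_display) (Om : measurableType d)
  (mu : {finite_measure set Om -> \bar R})
  (F : nat -> set_system Om)
  (T : (Om -> X) -> (Om -> X)) (T' : (Om -> R^o) -> (Om -> R^o))
  (p : R) (f : Om -> X) (Ef : nat -> nat -> Om -> X)
  (hX : reflexive_space X)
  (hF : monotone_sub_sigma_algebras F)
  (hT : L1_operator mu T)
  (hTT' : positive_dominant mu T T')
  (hT' : L1_Loo_contraction mu T')
  (hp : 1 < p)
  (hf : LB mu p%:E f)
  (hsup : mu.-integrable setT (sup_norm (fun n => ergodic_mean T n f)))
  (hEf : forall n1 n2 : nat, (0 < n1)%N -> (0 < n2)%N ->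
     is_cond_expectation mu (F n2) (ergodic_mean T n1 f) (Ef n1 n2)) :
  ('N[mu]_(p%:E) [sup_norm2 Ef] <= ((p / (p - 1)) ^+ 2)%:E * Bnorm mu p%:E f)%E
  /\
  (forall eps : R, 0 < eps ->
     (mu [set w | (eps%:E <= sup_norm2 Ef w)%E] <=
      ((p / (p - 1)) `^ p)%:E * (Bnorm mu p%:E f `^ p * ((eps `^ p)^-1)%:E))%E).
Proof.
have p0 : 0 < p by exact: lt_trans hp.
have p10 : 0 < p - 1 by rewrite subr_gt0.
have Lf := LB_sub_LB1 hp hf.
set S := fun n => ergodic_mean T n f in hsup *.
pose g := sup_norm S.
have mg : measurable_fun setT g by case/integrableP: hsup.
have gS n w : (0 < n)%N -> ((`|S n w|)%:E <= g w)%E.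
  by move=> n0; apply: ereal_sup_ubound; exists n.
have g0 w : (0 <= g w)%E by apply: le_trans (gS 1%N w isT).
have mf0 := measurable_norm_strongly hf.1.
set c := (p / (p - 1)) `^ p; set N := Bnorm mu p%:E f.
have gN : (\int[mu]_w (g w `^ p) <= c%:E * N `^ p)%E.
  rewrite Bnorm_poweR ?gt_eqF//; apply: weak_to_strong => // l l0.
  exact: (ergodic_maximal hT hTT' hT' Lf (ltW l0)).
pose M := sup_norm2 Ef.
have M0 w : (0 <= M w)%E.
  apply: (@le_trans _ _ (`|Ef 1%N 1%N w|)%:E) => //.
  by apply: ereal_sup_ubound; exists 1%N => //; exists 1%N.
have doob (l : R) : 0 <= l -> measurable [set w | l%:E < M w]%E /\
    (l%:E * mu [set w | l%:E < M w] <= \int[mu]_(w in [set w | l%:E < M w]) g w)%E.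
  move=> l0; apply: (doob_maximal (F := F)) => //.
    by move=> n1 n2 n10 n20; have [] := hEf _ _ n10 n20.
  move=> n1 n2 A n10 n20 FA; have [sF Fm] := hF.1 _ n20.
  have mS := strongly_measurable_ergodic_mean hT Lf n1.
  apply: (le_trans (cond_expectation_norm_le sF Fm mS (hEf _ _ n10 n20) FA)).
  have mA := Fm _ FA.
  apply: ge0_le_integral => //.
  - exact: measurable_funTS (measurable_norm_strongly mS).
  - exact: measurable_funTS.
  - by move=> w _; exact: gS.
have mM : measurable_fun setT M.
  by apply: measurable_fun_superlevel => // l l0; exact: (doob l l0).1.
split.
  have MN : (\int[mu]_w (M w `^ p) <= (((p / (p - 1)) ^+ 2)%:E * N) `^ p)%E.
    apply: (@le_trans _ _ (c%:E * \int[mu]_w (g w `^ p))%E).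
      by apply: weak_to_strong => // l l0; exact: (doob l (ltW l0)).2.
    rewrite poweRM//; [|by rewrite lee_fin sqr_ge0|exact: Lnorm_ge0].
    rewrite poweR_EFin expr2 powRM ?divr_ge0 ?(ltW p0) ?(ltW p10)// -/c EFinM -muleA.
    by rewrite lee_wpmul2l// lee_fin powR_ge0.
  rewrite unlock; under eq_integral do rewrite (gee0_abs (M0 _)).
  apply: (@le_trans _ _ (((((p / (p - 1)) ^+ 2)%:E * N) `^ p) `^ p^-1)%E).
    apply: gt0_ler_poweR => //; first by rewrite invr_ge0 ltW.
    - by rewrite in_itv/= leey andbT integral_ge0// => w _; exact: poweR_ge0.
    - by rewrite in_itv/= leey andbT poweR_ge0.
  rewrite -poweRrM mulfV ?gt_eqF// poweRe1//.
  by rewrite mule_ge0 ?lee_fin ?sqr_ge0// Lnorm_ge0.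
move=> eps eps0; set D := [set w | _].
have mD : measurable D.
  have -> : D = M @^-1` `[eps%:E, +oo[.
    by apply/seteqP; split => w /=; rewrite in_itv/= andbT.
  by rewrite -[X in measurable X]setTI; apply: mM => //; exact: emeasurable_itv.
have Nfin : (N `^ p \is a fin_num)%E.
  by rewrite ge0_fin_numE ?poweR_ge0// poweR_lty//; exact: hf.2.
(* the level sets at hand are defined by strict inequalities, so the bound is
   proved below eps and eps is approached from the left *)
have weak (l : R) : 0 < l -> l < eps -> ((l `^ p)%:E * mu D <= c%:E * N `^ p)%E.
  move=> l0 le; apply: le_trans gN.
  have [mE hE] := doob l (ltW l0).
  apply: le_trans (weak_type_Lp hp l0 mE mg g0 hE).
  rewrite lee_wpmul2l ?lee_fin ?powR_ge0//; apply: le_measure; rewrite ?inE//.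
  by move=> w /=; apply: lt_le_trans; rewrite lte_fin.
have lim : ((l `^ p)%:E * mu D)%E @[l --> eps^'-] --> ((eps `^ p)%:E * mu D)%E.
  apply: cvgeZr; first exact: fin_num_measure.
  apply: cvg_EFin; first exact: nearW.
  by apply: cvg_at_left_filter; exact: powR_continuous.
have : ((eps `^ p)%:E * mu D <= c%:E * N `^ p)%E.
  apply: (cvge_le _ lim); near=> l; apply: weak.
  - by near: l; exact: nbhs_left_gt.
  - by near: l; exact: nbhs_left_lt.
have ep0 : 0 < eps `^ p by exact: powR_gt0.
move=> h; rewrite muleA -(@lee_pmul2l _ (eps `^ p)%:E) ?lte_fin//.
by rewrite [X in (_ <= _ * X)%E]muleC muleA -EFinM mulfV ?gt_eqF// mul1e.
Unshelve. all: by end_near. Qed.
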